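(* For any $\epsilon\in(0,1]$, any finite sequence $1>\eta_1>\dots>\eta_J>0$, any sequence $\pi_k:\Omega\to\mathcal M_+^1(\Theta)$, $k\in\mathbb N^*$, where $\pi_k$ is a $k$-partially exchangeable posterior distribution, with $\mathbb P$ probability at least $1-\epsilon$, for any $\theta\in\Theta$, $$R(\theta)\le\inf_{k\in\mathbb N^*}\Biggl(\frac{k+1}k\inf_{\lambda\in\mathbb R_+}\Phi^{-1}_{\frac\lambda N}\Biggl[r_1(\theta)+\eta_J[1-r_1(\theta)]+\frac{d''_k[\theta,(\eta_j)_{j=1}^J]+\log[k(k+1)]}{\lambda}\Biggr]-\frac{r_1(\theta)}k\Biggr).$$
   Context: Setting. $N\ge1$ is an integer, $\mathcal X$ a measurable space, $\mathcal Y$ a finite set, $\Omega=[(\mathcal X\times\mathcal Y)^N]^{\mathbb N}$ with coordinate process $(X_l,Y_l)_{l\ge1}$, the $j$-th block ($j\ge0$) being $(X_{i+jN},Y_{i+jN})_{i=1}^N$. $\mathbb P=\bigl(\bigotimes_{i=1}^NP_i\bigr)^{\otimes\infty}$ where the $P_i$ are arbitrary probability measures on $\mathcal X\times\mathcal Y$: the blocks are i.i.d., each with distribution $\bigotimes_{i=1}^NP_i$; only the first block is observed. $\mathbb P'$ denotes conditional expectation under $\mathbb P$ given $(X_i,Y_i)_{i=1}^N$. $(\Theta,\mathcal T)$ is a measurable space, $\{f_\theta:\mathcal X\to\mathcal Y;\theta\in\Theta\}$ a jointly measurable family. $R(\theta)=\frac1N\sum_{i=1}^N\mathbb P[f_\theta(X_i)\ne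 Y_i]$, $r_1(\theta)=\frac1N\sum_{i=1}^N\mathbf 1[f_\theta(X_i)\ne Y_i]$. For $k\in\mathbb N^*$, $\Delta_k(\theta)=\{\theta'\in\Theta:f_{\theta'}(X_i)=f_\theta(X_i),\ i=1,\dots,(k+1)N\}$. A posterior distribution $\pi_k:\Omega\to\mathcal M_+^1(\Theta)$ (regular conditional probability measure) is $k$-partially exchangeable if, for each $i=1,\dots,N$, $\pi_k(\omega\circ s)=\pi_k(\omega)$ for every circular permutation $s$ of the ordered index set $\{i+jN:j=0,\dots,k\}$ (extended by the identity to the other indices). $$d'_k(\theta)=-\mathbb P'\bigl\{\log\{\epsilon\,\pi_k[\Delta_k(\theta)]\}\bigr\},$$ $$d''_k[\theta,(\eta_j)_{j=1}^J]=d'_k(\theta)+\log(J)-\log(\eta_1)+\sum_{j=1}^{J-1}\eta_j\log\Bigl(\frac{\eta_j}{\eta_{j+1}}\Bigr)+\log\Bigl(\frac{\epsilon\eta_J}{J}\Bigr)\eta_J.$$ For $a>0$ and $q\in\mathbb R$, $\Phi_a^{-1}(q)=\frac{1-\exp(-aq)}{1-\exp(-a)}$. The infimum in $\lambda$ is over $\lambda>0$. *)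

(* Defs.v *)
From HB Require Import structures.
From mathcomp Require Import all_boot all_order all_algebra.
From mathcomp Require Import all_classical all_reals all_analysis.
From mathcomp Require Import measurable_realfun.

Set Implicit Arguments.
Unset Strict Implicit.
Unset Printing Implicit Defensive.

Import Order.TTheory GRing.Theory Num.Theory.
Import numFieldNormedType.Exports.

Local Open Scope classical_set_scope.
Local Open Scope ring_scope.

(* Indices start at 0: coordinate l of a sequence w is the (l+1)-st observation,
   and block j consists of the coordinates i + j * N with i < N.  The space
   [(X * Y)^N]^nat is identified with the sequences of elements of X * Y,
   so that a permutation s of the indices acts by w \o s. *)

Definition coordinate_sets d (T : measurableType d) : set (set (nat -> T)) :=
  [set B | exists l A, measurable A /\ B = [set w | A (w l)]].

Notation sequences T := (g_sigma_algebraType (@coordinate_sets _ T)).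

Definition block_cylinder d (T : measurableType d) (N n : nat)
    (A : nat -> 'I_N -> set T) : set (sequences T) :=
  [set w | forall (j : nat) (i : 'I_N), (j < n)%N -> A j i (w (i + j * N)%N)].

(* P is the infinite product measure (P_0 \x ... \x P_(N-1))^(\otimes \infty);
   by a monotone class argument its values on cylinders determine it. *)
Definition iid_blocks d (T : measurableType d) (R : realType) (N : nat)
    (P_ : 'I_N -> probability T R) (P : probability (sequences T) R) : Prop :=
  forall (n : nat) (A : nat -> 'I_N -> set T),
    (forall j i, measurable (A j i)) ->
    P (block_cylinder n A) = (\prod_(j < n) \prod_(i < N) P_ i (A j i))%E.

Definition splice (T : Type) (N : nat) (w w' : nat -> T) : nat -> T :=
  fun l => if (l < N)%N then w l else w' l.

(* Conditional expectation given the first block, in its regular version: since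
   the blocks are independent, the first block is frozen and the others are
   integrated out.  A version fixed simultaneously for all h is needed because it
   is applied to an uncountable family of functions h.  See
   first_block_condexp_local, measurable_first_block_condexp and
   first_block_condexpE for the defining properties. *)
Definition first_block_condexp d (T : measurableType d) (R : realType) (N : nat)
    (P : probability (sequences T) R) (h : sequences T -> \bar R)
    (w : sequences T) : \bar R :=
  (\int[P]_w' h (splice N w w' : sequences T))%E.

(* s rotates {i + j N : j = 0, ..., k} by some number of steps m and fixes the
   other indices. *)
Definition circular_permutation (N k i : nat) (s : nat -> nat) : Prop :=
  exists m : nat,
    (forall j, (j <= k)%N -> s (i + j * N)%N = (i + ((j + m) %% k.+1) * N)%N) /\
    (forall l, (forall j, (j <= k)%N -> l <> (i + j * N)%N) -> s l = l).

Definition partially_exchangeable d d' (T : measurableType d)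
    (Theta : measurableType d') (R : realType) (N k : nat)
    (rho : R.-pker sequences T ~> Theta) : Prop :=
  forall (i : nat) (s : nat -> nat), (i < N)%N -> circular_permutation N k i s ->
  forall (w : sequences T) (A : set Theta), measurable A ->
    rho (w \o s : sequences T) A = rho w A.

Section classification.
Context d1 d2 d3 (X : measurableType d1) (Y : measurableType d2)
  (Theta : measurableType d3) (R : realType).
Context (N : nat) (f : Theta -> X -> Y).

Local Notation Omega := (sequences (X * Y)%type).

Definition risk (P : probability Omega R) (theta : Theta) : R :=
  N%:R^-1 * \sum_(i < N) fine (P [set w | f theta (w i).1 != (w i).2]).

Definition empirical_risk (w : Omega) (theta : Theta) : R :=
  N%:R^-1 * \sum_(i < N) (f theta (w i).1 != (w i).2)%:R.

Definition Delta (k : nat) (w : Omega) (theta : Theta) : set Theta :=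
  [set theta' | forall l, (l < k.+1 * N)%N ->
    f theta' (w l).1 = f theta (w l).1].

Definition d_prime (P : probability Omega R) (eps : R) (k : nat)
    (rho : R.-pker Omega ~> Theta) (w : Omega) (theta : Theta) : \bar R :=
  (- first_block_condexp N P
       (fun w' => lne (eps%:E * rho w' (Delta k w' theta))) w)%E.

(* eta j is only meant for 1 <= j <= J. *)
Definition d_second (P : probability Omega R) (eps : R) (k : nat)
    (rho : R.-pker Omega ~> Theta) (J : nat) (eta : nat -> R)
    (w : Omega) (theta : Theta) : \bar R :=
  (d_prime P eps k rho w theta
   + (ln J%:R - ln (eta 1%N)
      + \sum_(1 <= j < J) eta j * ln (eta j / eta j.+1)
      + ln (eps * eta J / J%:R) * eta J)%:E)%E.

End classification.

(* Phi_a^{-1}, extended by continuity to q = +oo (d' may be infinite). *)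
Definition Phi_inv (R : realType) (a : R) (q : \bar R) : \bar R :=
  ((1 - expeR (- (a%:E * q))) * (1 - expR (- a))^-1%:E)%E.

Lemma measurable_coordinate d (T : measurableType d) (l : nat) :
  measurable_fun [set: sequences T] (fun w : sequences T => w l : T).
Proof.
move=> _ A mA; rewrite setTI; apply: sub_sigma_algebra.
by exists l, A; split.
Qed.

Lemma measurable_to_sequences d (T : measurableType d) d'
    (S : measurableType d') (g : S -> sequences T) :
  (forall l, measurable_fun [set: S] (fun x => g x l : T)) ->
  measurable_fun [set: S] g.
Proof.
move=> mg; apply: (@measurability _ _ S (sequences T) setT g
  (@coordinate_sets _ T)) => //.
move=> _ [_ [l [A [mA ->]]] <-].
exact: mg.
Qed.

Lemma measurable_splice d (T : measurableType d) (N : nat) :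
  measurable_fun [set: (sequences T * sequences T)%type]
    (fun p : sequences T * sequences T => splice N p.1 p.2 : sequences T).
Proof.
apply: measurable_to_sequences => l; rewrite /splice; case: (l < N)%N.
- exact: (measurableT_comp (measurable_coordinate l)
    (@measurable_fst _ _ (sequences T) (sequences T))).
- exact: (measurableT_comp (measurable_coordinate l)
    (@measurable_snd _ _ (sequences T) (sequences T))).
Qed.

Lemma measurable_block_cylinder d (T : measurableType d) (N n : nat)
    (A : nat -> 'I_N -> set T) :
  (forall j i, measurable (A j i)) -> measurable (block_cylinder n A).
Proof.
move=> mA.
have -> : block_cylinder n A = \bigcap_(j in [set j | (j < n)%N])
    \bigcap_(i in [set: 'I_N]) [set w : sequences T | A j i (w (i + j * N)%N)].
  by apply/seteqP; split=> [w h j jn i _|w h j i jn]; exact: h.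
apply: fin_bigcap_measurable => [|j jn]; first exact: finite_II.
apply: fin_bigcap_measurable => [|i _]; first exact: finite_finset.
by have := measurable_coordinate (i + j * N) measurableT (mA j i); rewrite setTI.
Qed.

Lemma preimage_splice_cylinder d (T : measurableType d) (N n : nat)
    (A : nat -> 'I_N -> set T) :
  (fun p : sequences T * sequences T => splice N p.1 p.2 : sequences T)
    @^-1` block_cylinder n.+1 A =
  block_cylinder 1 A `*`
  block_cylinder n.+1 (fun j i => if j == 0%N then [set: T] else A j i).
Proof.
have lt_block j i : (i < N)%N -> (i + j * N < N)%N = (j == 0%N).
  by case: j => [|j] iN; rewrite ?mul0n ?addn0 // mulSn addnCA ltnNge leq_addr.
apply/seteqP; split=> [[w w'] /= h|[w w'] /= [h1 h2] j i jn]; last first.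
  rewrite /splice lt_block //; case: eqP => [j0|/eqP j0].
  - by apply: h1; rewrite j0.
  - by have := h2 j i jn; rewrite (negPf j0).
split=> j i jn.
- have j0 : j = 0%N by case: j jn.
  by have := h j i; rewrite /splice lt_block // j0 /=; exact.
- case: eqP => // /eqP j0.
  by have := h j i jn; rewrite /splice lt_block // (negPf j0).
Qed.

Lemma sequences_measure_unique d (T : measurableType d) (R : realType)
    (N : nat) (m1 m2 : {measure set (sequences T) -> \bar R}) :
  (0 < N)%N -> (m1 [set: sequences T] < +oo)%E ->
  (forall n (A : nat -> 'I_N -> set T), (forall j i, measurable (A j i)) ->
    m1 (block_cylinder n.+1 A) = m2 (block_cylinder n.+1 A)) ->
  forall B, measurable B -> m1 B = m2 B.
Proof.
move=> N0 m1oo m12 B mB.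
pose G : set (set (sequences T)) := [set C | exists n (A : nat -> 'I_N -> set T),
  (forall j i, measurable (A j i)) /\ C = block_cylinder n.+1 A].
have GT : G [set: sequences T].
  exists 0%N, (fun _ _ => setT); split=> //.
  by apply/seteqP; split.
apply: (measure_unique G (fun=> setT)) => //.
- apply/seteqP; split.
  + apply: smallest_sub; first exact: smallest_sigma_algebra.
    move=> _ [l [A [mA ->]]]; apply: sub_sigma_algebra.
    exists (l %/ N)%N, (fun j i => if (i + j * N == l)%N then A else setT); split.
      by move=> j i; case: ifP.
    have lN : (l %% N < N)%N by rewrite ltn_mod.
    apply/seteqP; split=> [w /= Aw j i _|w /= /(_ (l %/ N)%N (Ordinal lN))].
      by case: eqP => // ->.
    by rewrite /= addnC -divn_eq eqxx ltnS leqnn; exact.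
  + apply: smallest_sub; first exact: sigma_algebra_measurable.
    by move=> _ [n [A [mA ->]]]; exact: measurable_block_cylinder.
- move=> _ _ [n [A [mA ->]]] [m [A' [mA' ->]]].
  exists (maxn n m), (fun j i => (if (j <= n)%N then A j i else setT) `&`
                                 (if (j <= m)%N then A' j i else setT)).
  split; first by move=> j i; apply: measurableI; case: ifP.
  apply/seteqP; split=> [w /= [h h'] j i _|w /= h].
  + by split; case: ifPn => // ?; [exact: h|exact: h'].
  + split=> j i; rewrite ltnS => jn; have := h j i; rewrite ltnS leq_max jn ?orbT.
    * by case/(_ isT).
    * by case/(_ isT).
- by rewrite bigcup_const.
- by move=> _ [n [A [mA ->]]]; exact: m12.
Qed.

Section first_block_condexp_theory.
Context d (T : measurableType d) (R : realType) (N : nat).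
Implicit Types (P : probability (sequences T) R) (h : sequences T -> \bar R).

Lemma first_block_condexp_local P h (w1 w2 : sequences T) :
  (forall l, (l < N)%N -> w1 l = w2 l) ->
  first_block_condexp N P h w1 = first_block_condexp N P h w2.
Proof.
move=> w12; apply: eq_integral => w' _; congr h.
by apply/funext => l; rewrite /splice; case: ifPn => // /w12.
Qed.

Lemma measurable_first_block_condexp P h :
  measurable_fun [set: sequences T] h -> (forall w, 0 <= h w)%E ->
  measurable_fun [set: sequences T] (first_block_condexp N P h).
Proof.
move=> mh h0; rewrite /first_block_condexp.
pose phi (p : sequences T * sequences T) : sequences T := splice N p.1 p.2.
apply: (measurable_fun_fubini_tonelli_F (m2 := P) (h \o phi)) => [|p].
- exact: measurableT_comp mh (measurable_splice N).
- exact: h0.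
Qed.

Variables (P_ : 'I_N -> probability T R) (P : probability (sequences T) R).
Hypotheses (N0 : (0 < N)%N) (PP : iid_blocks P_ P).

Lemma splice_measure B : measurable B ->
  ((P \x P) ((fun p => splice N p.1 p.2 : sequences T) @^-1` B) = P B)%E.
Proof.
move=> mB.
pose m := measure_function_pushforward__canonical__measure_function_Measure
  (P \x P)%E (measurable_splice (T := T) N).
apply: (sequences_measure_unique (m1 := m) N0) mB => [|n A mA].
  rewrite /= /pushforward preimage_setT -setXTT product_measure1E //.
  by rewrite -ge0_fin_numE ?mule_ge0 // fin_numM ?fin_num_measure.
rewrite /= /pushforward preimage_splice_cylinder.
have mA' j i : measurable (if j == 0%N then [set: T] else A j i) by case: ifP.
rewrite product_measure1E; [|exact: measurable_block_cylinder..].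
rewrite [RHS](PP n.+1 mA).
pose A' j i := if j == 0%N then [set: T] else A j i.
transitivity ((\prod_(j < 1) \prod_(i < N) P_ i (A j i)) *
              (\prod_(j < n.+1) \prod_(i < N) P_ i (A' j i)))%E.
  by congr (_ * _)%E; [exact: (PP 1 mA)|exact: (PP n.+1 mA')].
rewrite big_ord1 !big_ord_recl /= [X in (_ * (X * _))%E]big1 ?mul1e //.
by move=> i _; exact: probability_setT.
Qed.

Lemma first_block_condexpE h (B : set (sequences T)) :
  measurable_fun [set: sequences T] h -> (forall w, 0 <= h w)%E ->
  measurable B ->
  (forall w1 w2, (forall l, (l < N)%N -> w1 l = w2 l) -> B w1 -> B w2) ->
  (\int[P]_(w in B) first_block_condexp N P h w = \int[P]_(w in B) h w)%E.
Proof.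
move=> mh h0 mB Bloc.
pose phi (p : sequences T * sequences T) : sequences T := splice N p.1 p.2.
pose g := (h \_ B)%R.
have mg : measurable_fun [set: sequences T] g.
  by apply/(measurable_restrictT _ mB); exact: measurable_funTS.
have g0 w : (0 <= g w)%E by rewrite /g patchE; case: ifP.
transitivity (\int[P]_w first_block_condexp N P g w)%E.
  rewrite integral_mkcond; apply: eq_integral => w _; rewrite patchE.
  have BE w' : (splice N w w' \in B) = (w \in B).
    by apply/idP/idP; rewrite !inE; apply: Bloc => l lN; rewrite /splice lN.
  rewrite /first_block_condexp; case: ifPn => wB; last first.
    rewrite integral0_eq // => w' _.
    by rewrite /g patchE BE (negPf wB).
  by apply: eq_integral => w' _; rewrite /g patchE BE wB.
rewrite [RHS]integral_mkcond -/g.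
have mgphi : measurable_fun setT (g \o phi).
  exact: measurableT_comp mg (measurable_splice N).
have gphi0 p : (0 <= (g \o phi) p)%E by exact: g0.
transitivity (\int[P \x P]_p (g \o phi) p)%E.
  by rewrite (fubini_tonelli1 (m1 := P) (m2 := P) (g \o phi)).
transitivity (\int[pushforward (P \x P)%E phi]_w g w)%E.
  apply/esym.
  exact: (ge0_integral_pushforward (measurable_splice N) (P \x P)%E measurableT mg).
apply: eq_measure_integral => [|? A mA _]; first exact: measurable_splice.
exact: splice_measure.
Qed.
End first_block_condexp_theory.

(* Main.v *)
(* Rotating the columns {i + j N : j <= k}, i < N, independently preserves both P
   and pi_k, and under a uniform random choice of these rotations the empirical
   risk of theta becomes a mean of N independent draws, one per column.  Its
   exponential moment is then bounded by means of the arithmetic-geometric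
   inequality, so the event that some theta and some a > 0 satisfy
   exp (a N (Phi_a (mean risk) - empirical risk)) > 1 / (g pi_k(Delta_k theta))
   has probability at most g.  By Markov's inequality and a union bound over k
   and j, with probability at least 1 - eps the conditional probability of this
   event for g = eps eta_j / (J k (k + 1)) is at most eta_j for all k and j.
   Outside of the j-th event the mean risk is controlled with the j-th level, and
   it is always at most 1 = r1 + (1 - r1).  Summing over the layers, and
   linearizing the concave function Phi_a^{-1} at the target value before
   integrating, gives a bound on the conditional mean (r1 + k R) / (k + 1). *)

Require Import Defs.
From HB Require Import structures.
From mathcomp Require Import all_boot all_order all_algebra.
From mathcomp Require Import all_classical all_reals all_analysis.
From mathcomp Require Import measurable_realfun ring lra.

Set Implicit Arguments.
Unset Strict Implicit.
Unset Printing Implicit Defensive.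

Import Order.TTheory GRing.Theory Num.Theory.
Import numFieldNormedType.Exports.

Local Open Scope classical_set_scope.
Local Open Scope ring_scope.

(** * Rotations of the blocks *)

(** Block numbers beyond [k] are fixed, as [circular_permutation] demands, so that the rotation is a
    bijection of all block numbers. *)
Definition cyc (k m j : nat) : nat := (if j <= k then (j + m) %% k.+1 else j)%N.

Lemma cyc0 k j : cyc k 0 j = j.
Proof. by rewrite /cyc; case: ifP => // jk; rewrite addn0 modn_small. Qed.

Lemma cycD k m m' j : cyc k m (cyc k m' j) = cyc k (m' + m) j.
Proof.
rewrite /cyc; case: (leqP j k) => [jk|kj]; last by rewrite leqNgt kj.
by rewrite -ltnS ltn_mod modnDml addnA.
Qed.

(** Any initial segment containing the first [k.+1] blocks is stable; finite products over blocks
    can therefore be reindexed by a rotation. *)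
Lemma cyc_bound k m j M : (j < k.+1 + M)%N -> (cyc k m j < k.+1 + M)%N.
Proof.
rewrite /cyc; case: ifP => // jk _.
by rewrite (@leq_trans k.+1) ?ltn_mod// leq_addr.
Qed.

(** When [k.+1] divides [m] this is [k.+1] rather than 0, which is harmless since rotations only
    depend on the step modulo [k.+1]. *)
Definition cyc_opp (k m : nat) : nat := (k.+1 - m %% k.+1)%N.

Lemma cyc_periodic k m j : cyc k (m %% k.+1) j = cyc k m j.
Proof. by rewrite /cyc modnDmr. Qed.

Lemma cycK k m : cancel (cyc k m) (cyc k (cyc_opp k m)).
Proof.
move=> j; rewrite cycD -cyc_periodic -modnDml /cyc_opp subnKC ?modnn ?cyc0//.
by rewrite ltnW// ltn_mod.
Qed.

Lemma cycVK k m : cancel (cyc k (cyc_opp k m)) (cyc k m).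
Proof.
move=> j; rewrite cycD addnC -cyc_periodic -modnDml /cyc_opp.
by rewrite subnKC ?modnn ?cyc0// ltnW// ltn_mod.
Qed.

(* Rotates the column [{i + j N : j <= k}] by [m i] steps, for all [i < N] at
   once. *)
Definition rot_blocks (N k : nat) (m : nat -> nat) (l : nat) : nat :=
  (l %% N + cyc k (m (l %% N)) (l %/ N) * N)%N.

Lemma rot_blocksE N k m i j : (i < N)%N ->
  rot_blocks N k m (i + j * N) = (i + cyc k (m i) j * N)%N.
Proof.
move=> iN; have N0 : (0 < N)%N by exact: leq_ltn_trans iN.
by rewrite /rot_blocks [(i + _)%N]addnC modnMDl divnMDl// modn_small// divn_small// addn0.
Qed.

Lemma rot_blocks0 N k l : rot_blocks N k (fun=> 0%N) l = l.
Proof. by rewrite /rot_blocks cyc0 addnC -divn_eq. Qed.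

Lemma circular_permutation_rot N k i m : (i < N)%N ->
  circular_permutation N k i (rot_blocks N k (fun n => if n == i then m else 0%N)).
Proof.
move=> iN; exists m; split=> [j jk|l hl].
  by rewrite rot_blocksE// eqxx /cyc jk.
rewrite /rot_blocks; case: eqP => [li|_]; last by rewrite cyc0 addnC -divn_eq.
rewrite /cyc; case: ifP => [lk|_]; last by rewrite addnC -divn_eq.
by have /= := hl _ lk; rewrite -li addnC -divn_eq.
Qed.

(** A simultaneous rotation is a composition of rotations of single columns, and each of these
    leaves [rho] unchanged. *)
Lemma partially_exchangeable_rot d d' (T : measurableType d)
    (Theta : measurableType d') (R : realType) (N k : nat)
    (rho : R.-pker sequences T ~> Theta) (m : nat -> nat) :
  (0 < N)%N -> partially_exchangeable N k rho ->
  forall (w : sequences T) (A : set Theta), measurable A ->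
    rho (w \o rot_blocks N k m : sequences T) A = rho w A.
Proof.
move=> N0 exch w A mA; pose m_ n i := if (i < n)%N then m i else 0%N.
have -> : w \o rot_blocks N k m = w \o rot_blocks N k (m_ N).
  by apply/funext => l; rewrite /= /rot_blocks /m_ ltn_mod N0.
have : (N <= N)%N by [].
(* Induction on the number [n] of columns already rotated; the block size [N] itself stays fixed. *)
elim: {1 4}N => [_|n IH nN].
  congr (rho _ A); apply/funext => l /=; congr w.
  by rewrite -[RHS](rot_blocks0 N k) /rot_blocks.
rewrite -(IH (ltnW nN)).
rewrite -[RHS](exch _ _ nN (circular_permutation_rot k (m n) nN) _ _ mA).
congr (rho _ A); apply/funext => l /=; congr w.
have lN : (l %% N < N)%N by rewrite ltn_mod.
have -> : l = (l %% N + l %/ N * N)%N by rewrite addnC -divn_eq.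
rewrite !rot_blocksE// /m_ ltnS leq_eqVlt.
by have [->|_] := eqVneq (l %% N)%N n; rewrite /= ?ltnn cyc0.
Qed.

Lemma measurable_comp_indices d (T : measurableType d) (s : nat -> nat) :
  measurable_fun [set: sequences T] (fun w : sequences T => w \o s : sequences T).
Proof.
by apply: measurable_to_sequences => l; exact: (measurable_coordinate (s l)).
Qed.

(** Within column [i] all coordinates have the same law [P_ i], so a rotation only permutes equal
    factors of the product giving the measure of a cylinder. *)
Lemma iid_blocks_rot d (T : measurableType d) (R : realType) (N k : nat)
    (P_ : 'I_N -> probability T R) (P : probability (sequences T) R)
    (m : nat -> nat) :
  (0 < N)%N -> iid_blocks P_ P -> forall B : set (sequences T), measurable B ->
  P [set w : sequences T | B (w \o rot_blocks N k m)] = P B.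
Proof.
move=> N0 PP B mB.
pose Q := measure_function_pushforward__canonical__measure_function_Measure
  P (measurable_comp_indices (T := T) (rot_blocks N k m)).
apply: (sequences_measure_unique (m1 := Q) N0) mB => [|n A mA].
  by rewrite /Q /= /pushforward preimage_setT probability_setT ltey.
rewrite /Q /= /pushforward.
(* The cylinder is padded with full sets up to [M] blocks, a range that contains both the cylinder
   and the rotated blocks. *)
pose A' j i := if (j < n.+1)%N then A j i else setT.
pose M := (k.+1 + n.+1)%N.
pose A'' j i := A' (cyc k (cyc_opp k (m (i : 'I_N))) j) i.
have mA' j i : measurable (A' j i) by rewrite /A'; case: ifP.
have cA : block_cylinder n.+1 A = block_cylinder M A' :> set (sequences T).
  apply/seteqP; split=> w /= h j i jn.
    by rewrite /A'; case: ifP => // jn'; exact: h.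
  by have := h j i; rewrite /A' jn; apply; rewrite (leq_trans jn)// leq_addl.
have cA' : (fun w : sequences T => w \o rot_blocks N k m : sequences T) @^-1`
    block_cylinder n.+1 A = block_cylinder M A''.
  rewrite cA; apply/seteqP; split=> w /= h j i jM.
  - have := h (cyc k (cyc_opp k (m i)) j) i (cyc_bound _ jM).
    by rewrite /= rot_blocksE// cycVK.
  - have := h (cyc k (m i) j) i (cyc_bound _ jM).
    by rewrite /A'' cycK /= rot_blocksE.
rewrite cA' cA (PP _ _ mA') PP; last by move=> j i; exact: mA'.
rewrite exchange_big [RHS]exchange_big /=; apply: eq_bigr => i _.
pose h (j : 'I_M) : 'I_M := Ordinal (cyc_bound (m i) (ltn_ord j)).
rewrite (reindex_inj (h := h)) /=; last first.
  by move=> j j' /(congr1 val)/= /(can_inj (@cycK k (m i))) /val_inj.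
by apply: eq_bigr => j _; rewrite /A'' cycK.
Qed.

(** * Deviations along rotations *)

(** The sum over all choices of one entry per column factors into a product over columns. On
    booleans the exponential is affine, so each factor is affine in the number of errors of its
    column. *)
Lemma sum_expR_transversal (R : realType) (N k : nat) (e : 'I_N -> 'I_k.+1 -> bool)
    (a : R) : (0 < N)%N -> 0 < a ->
  \sum_(m : {ffun 'I_N -> 'I_k.+1}) expR (- (a * \sum_i (e i (m i))%:R)) <=
  k.+1%:R ^+ N * (1 - (1 - expR (- a)) *
    ((N%:R * k.+1%:R)^-1 * \sum_i \sum_j (e i j)%:R)) ^+ N.
Proof.
move=> N0 a0; pose c := 1 - expR (- a).
have Nn0 : N%:R != 0 :> R by rewrite pnatr_eq0 -lt0n.
have eE b : expR (- (a * (b : bool)%:R)) = 1 - c * b%:R :> R.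
  case: b; first by rewrite !mulr1 /c subKr.
  by rewrite !mulr0 oppr0 expR0 addr0.
have -> : \sum_(m : {ffun 'I_N -> 'I_k.+1}) expR (- (a * \sum_i (e i (m i))%:R))
    = \prod_i \sum_j expR (- (a * (e i j)%:R)).
  rewrite bigA_distr_bigA /=; apply: eq_bigr => m _.
  by rewrite mulr_sumr -sumrN expR_sum.
have -> : \prod_i \sum_j expR (- (a * (e i j)%:R)) =
    \prod_i (k.+1%:R - c * \sum_j (e i j)%:R).
  apply: eq_bigr => i _; under eq_bigr do rewrite eE.
  by rewrite big_split /= sumr_const card_ord sumrN -mulr_sumr.
pose E (i : 'I_N) := k.+1%:R - c * \sum_j (e i j)%:R.
have E0 i : 0 <= E i.
  rewrite subr_ge0.
  have c0 : 0 <= c by rewrite subr_ge0 -expR0 ler_expR oppr_le0 ltW.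
    have c1 : c <= 1 by rewrite gerBl expR_ge0.
    rewrite -[leRHS]mul1r ler_pM ?sumr_ge0//.
    rewrite (@le_trans _ _ (\sum_(j < k.+1) 1))//; last first.
      by rewrite sumr_const card_ord.
    by apply: ler_sum => j _; case: (e i j); rewrite ?ler01.
(* The arithmetic-geometric inequality replaces the factors of the columns by their common mean. *)
have [le_prod _] := @leif_AGM R 'I_N predT E (fun i _ => E0 i).
apply: le_trans le_prod _.
rewrite card_ord -exprMn le_eqVlt; apply/orP; left; apply/eqP; congr (_ ^+ N).
rewrite big_split /= sumr_const card_ord sumrN -mulr_sumr -/c.
have K0 : k.+1%:R != 0 :> R by rewrite pnatr_eq0.
rewrite -mulr_natr; move: k.+1%:R K0 => K K0; by field; rewrite K0 Nn0.
Qed.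

(** The value 0 outside of ['I_N] is never read for [N > 0]: [rot_blocks] evaluates its steps at
    residues modulo [N] only. *)
Definition ord_ext (N k : nat) (m : {ffun 'I_N -> 'I_k.+1}) (i : nat) : nat :=
  if insub i is Some i' then m i' else 0%N.

Lemma ord_extE N k (m : {ffun 'I_N -> 'I_k.+1}) (i : 'I_N) : ord_ext m i = m i.
Proof. by rewrite /ord_ext valK. Qed.

Section rotated_risks.
Context d1 d2 d3 (X : measurableType d1) (Y : measurableType d2)
  (Theta : measurableType d3) (R : realType).
Context (N k : nat) (f : Theta -> X -> Y).
Hypothesis N_gt0 : (0 < N)%N.

Local Notation Omega := (sequences (X * Y)%type).
Implicit Types (w : Omega) (theta : Theta).

(** Summed by columns, so that a rotation merely permutes each inner sum. *)
Definition mean_risk w theta : R :=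
  (N%:R * k.+1%:R)^-1 * \sum_(i < N) \sum_(j < k.+1)
    (f theta (w (i + j * N)%N).1 != (w (i + j * N)%N).2)%:R.

Lemma mean_risk_ge0 w theta : 0 <= mean_risk w theta.
Proof.
rewrite mulr_ge0 ?invr_ge0 ?mulr_ge0// sumr_ge0// => i _.
by rewrite sumr_ge0.
Qed.

Lemma mean_risk_le1 w theta : mean_risk w theta <= 1.
Proof.
rewrite /mean_risk ler_pdivrMl ?mulr_gt0 ?ltr0n// mulr1.
apply: (@le_trans _ _ (\sum_(i < N) \sum_(j < k.+1) 1)).
  by apply: ler_sum => i _; apply: ler_sum => j _; case: eqP.
by rewrite !sumr_const !card_ord -mulrnA -natrM mulnC.
Qed.

Lemma DeltaE w theta : Delta N f k w theta =
  [set theta' | forall (i : 'I_N) (j : 'I_k.+1),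
    f theta' (w (i + j * N)%N).1 = f theta (w (i + j * N)%N).1].
Proof.
apply/seteqP; split=> theta' /= h.
  move=> i j; apply: h; rewrite (@leq_trans (j.+1 * N)) ?leq_mul2r ?ltn_ord ?orbT//.
  by rewrite mulSn ltn_add2r.
move=> l lN; have li : (l %% N < N)%N by rewrite ltn_mod.
have lj : (l %/ N < k.+1)%N by rewrite ltn_divLR.
by have := h (Ordinal li) (Ordinal lj); rewrite /= addnC -divn_eq.
Qed.

(** Rotating column [i] by [m i] brings its entry of block [m i] into the first block. *)
Lemma empirical_risk_rot (m : {ffun 'I_N -> 'I_k.+1}) w theta :
  empirical_risk R N f (w \o rot_blocks N k (ord_ext m)) theta =
  N%:R^-1 * \sum_(i < N)
    (f theta (w (i + m i * N)%N).1 != (w (i + m i * N)%N).2)%:R.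
Proof.
rewrite /empirical_risk; congr (_ * _); apply: eq_bigr => i _ /=.
have -> : rot_blocks N k (ord_ext m) i = (i + m i * N)%N.
  rewrite -[X in rot_blocks _ _ _ X](addn0 i) -[X in (i + X)%N](mul0n N).
  by rewrite rot_blocksE// ord_extE /cyc leq0n add0n modn_small.
by [].
Qed.

(** Rotation is addition in the cyclic group ['I_k.+1], hence invertible by subtraction. *)
Lemma cyc_ord (j m : 'I_k.+1) : cyc k m j = (j + m)%R.
Proof. by rewrite /cyc -ltnS ltn_ord. Qed.

Lemma mean_risk_rot (m : {ffun 'I_N -> 'I_k.+1}) w theta :
  mean_risk (w \o rot_blocks N k (ord_ext m)) theta = mean_risk w theta.
Proof.
rewrite /mean_risk; congr (_ * _); apply: eq_bigr => i _.
rewrite [RHS](reindex_inj (addIr (m i))) /=; apply: eq_bigr => j _.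
by rewrite rot_blocksE// ord_extE cyc_ord.
Qed.

Lemma Delta_rot (m : {ffun 'I_N -> 'I_k.+1}) w theta :
  Delta N f k (w \o rot_blocks N k (ord_ext m)) theta = Delta N f k w theta.
Proof.
rewrite !DeltaE; apply/seteqP; split=> theta' /= h i j.
- have := h i (j - m i).
  by rewrite rot_blocksE// ord_extE cyc_ord subrK.
- by rewrite rot_blocksE// ord_extE cyc_ord; exact: h.
Qed.

Lemma mean_risk_Delta w theta theta' : Delta N f k w theta theta' ->
  mean_risk w theta' = mean_risk w theta.
Proof.
rewrite DeltaE => h; rewrite /mean_risk; congr (_ * _).
by apply: eq_bigr => i _; apply: eq_bigr => j _; rewrite h.
Qed.

Lemma Delta_eq w theta theta' : Delta N f k w theta theta' ->
  Delta N f k w theta' = Delta N f k w theta.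
Proof.
move=> h; apply/seteqP; split=> t /= ht l lN; rewrite ht//; first exact: h.
by rewrite h.
Qed.

Lemma empirical_risk_Delta w theta theta' : Delta N f k w theta theta' ->
  empirical_risk R N f w theta' = empirical_risk R N f w theta.
Proof.
move=> h; rewrite /empirical_risk; congr (_ * _); apply: eq_bigr => i _.
by rewrite h// (leq_trans (ltn_ord i))// leq_pmull.
Qed.

End rotated_risks.

(* [exp (a N (r - Phi_a p))], where [Phi_a] is the inverse of [Phi_inv a]. *)
Definition dev_weight (R : realType) (N : nat) (a p r : R) : R :=
  ((1 - (1 - expR (- a)) * p) * expR (a * r)) ^+ N.

(** The expression decreases in [p] and equals [expR (- a)] at [p = 1]. *)
Lemma dev_base_gt0 (R : realType) (a p : R) : 0 < a -> p <= 1 ->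
  0 < 1 - (1 - expR (- a)) * p.
Proof.
move=> a0 p1; have := expR_gt0 (- a).
have : expR (- a) < 1 by rewrite -expR0 ltr_expR oppr_lt0.
nra.
Qed.

Lemma dev_weight_gt0 (R : realType) (N : nat) (a p r : R) : 0 < a -> p <= 1 ->
  0 < dev_weight N a p r.
Proof.
by move=> a0 p1; rewrite exprn_gt0// mulr_gt0 ?expR_gt0// dev_base_gt0.
Qed.

Section deviation_event.
Context d1 d2 d3 (X : measurableType d1) (Y : measurableType d2)
  (Theta : measurableType d3) (R : realType).
Context (N k : nat) (f : Theta -> X -> Y).
Hypothesis N_gt0 : (0 < N)%N.

Local Notation Omega := (sequences (X * Y)%type).
Implicit Types (w : Omega) (theta : Theta).
Variable rho : R.-pker Omega ~> Theta.
Hypothesis mDelta : forall w theta, measurable (Delta N f k w theta).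
Hypothesis exch : partially_exchangeable N k rho.

(** Quantifying [a] inside the event is what makes the final bound uniform in [lambda]. In this
    product form, a class of mass zero never deviates. *)
Definition deviates (g : R) w theta : Prop :=
  exists2 a : R, 0 < a &
    dev_weight N a (mean_risk R N k f w theta) (empirical_risk R N f w theta) <
    g * fine (rho w (Delta N f k w theta)).

(** Deviation depends on [theta] only through its class [Delta]; this reduces a union over [Theta]
    to one over finitely many classes. *)
Lemma deviates_Delta g w theta theta' : Delta N f k w theta theta' ->
  deviates g w theta' -> deviates g w theta.
Proof.
move=> h [a a0]; rewrite (mean_risk_Delta _ N_gt0 h) (empirical_risk_Delta _ h).
by rewrite (Delta_eq h); exists a.
Qed.

(* All rotations of w share the same mean risk; taking the parameter a that
   witnesses the deviation with the largest empirical risk, a single exponential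
   inequality controls all the rotations for which theta deviates. *)
Lemma sum_deviates_rot (g : R) w theta : 0 <= g ->
  \sum_(m : {ffun 'I_N -> 'I_k.+1})
    (`[< deviates g (w \o rot_blocks N k (ord_ext m)) theta >])%:R <=
  g * fine (rho w (Delta N f k w theta)) * k.+1%:R ^+ N.
Proof.
move=> g0; set G := g * _; pose p := mean_risk R N k f w theta.
have G0 : 0 <= G by rewrite mulr_ge0// fine_ge0.
pose r (m : {ffun 'I_N -> 'I_k.+1}) :=
  empirical_risk R N f (w \o rot_blocks N k (ord_ext m)) theta.
pose D := [pred m : {ffun 'I_N -> 'I_k.+1} |
  `[< deviates g (w \o rot_blocks N k (ord_ext m)) theta >]].
have DP m : D m -> exists2 a : R, 0 < a & dev_weight N a p (r m) < G.
  move/asboolP => [a a0]; rewrite mean_risk_rot// Delta_rot//.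
  by rewrite partially_exchangeable_rot//; exists a.
have [m0 Dm0|D0] := pickP D; last first.
  by rewrite big1 ?mulr_ge0 ?exprn_ge0// => m _; have /= -> := D0 m.
case: (arg_maxP r Dm0) => m1 Dm1 max_m1.
have [a a0 aG] := DP _ Dm1.
pose u := 1 - (1 - expR (- a)) * p.
have u0 : 0 < u by apply: dev_base_gt0 => //; exact: mean_risk_le1.
have Nn0 : N%:R != 0 :> R by rewrite pnatr_eq0 -lt0n.
(* An exponential Markov bound: since [r m <= r m1], the inequality at [m1] also dominates the
   weight of every other deviating [m], with the same [a]. *)
have bound m : (D m)%:R <= G / u ^+ N *
    expR (- (a * \sum_(i < N) (f theta (w (i + m i * N)%N).1 != (w (i + m i * N)%N).2)%:R)).
  have [Dm|_] := boolP (D m); last by rewrite mulr_ge0 ?expR_ge0// divr_ge0// exprn_ge0// ltW.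
  rewrite mulrAC ler_pdivlMr ?exprn_gt0// mul1r expRN ler_pdivlMr ?expR_gt0//.
  apply: le_trans (ltW aG); rewrite /dev_weight -/u exprMn -expRM_natr.
  rewrite ler_pM2l ?exprn_gt0// ler_expR -mulrA ler_pM2l//.
  have : r m <= r m1 by exact: max_m1.
  by rewrite {1}/r empirical_risk_rot// ler_pdivrMl ?ltr0n// [_ * r m1]mulrC.
apply: (@le_trans _ _ (\sum_(m : {ffun 'I_N -> 'I_k.+1}) (G / u ^+ N *
    expR (- (a * \sum_(i < N) (f theta (w (i + m i * N)%N).1 != (w (i + m i * N)%N).2)%:R))))).
  by apply: ler_sum => m _; exact: bound.
rewrite -mulr_sumr.
have := sum_expR_transversal
  (fun (i : 'I_N) (j : 'I_k.+1) => f theta (w (i + j * N)%N).1 != (w (i + j * N)%N).2)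
  N_gt0 a0.
rewrite -/(mean_risk R N k f w theta) -/p -/u.
have uN0 : u ^+ N != 0 by rewrite expf_neq0 ?gt_eqF.
have Gu0 : 0 <= G / u ^+ N by rewrite divr_ge0// exprn_ge0// ltW.
move=> /(ler_wpM2l Gu0) /le_trans; apply.
by rewrite mulrCA divfK// mulrC.
Qed.
End deviation_event.

(** * Probability of the deviation event *)

Lemma integral_sum_indic d (T : measurableType d) (R : realType)
    (P : probability T R) (I : finType) (A : I -> set T) :
  (forall i, measurable (A i)) ->
  (\int[P]_t (\sum_i \1_(A i) t)%:E = \sum_i P (A i))%E.
Proof.
move=> mA; under eq_integral do rewrite -sumEFin.
rewrite ge0_integral_sum//; last first.
  by move=> i; apply/measurable_EFinP; exact: measurable_indic.
by under eq_bigr do rewrite integral_indic// setIT.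
Qed.

Lemma sum_probability_le d (T : measurableType d) (R : realType)
    (P : probability T R) (I : finType) (A : I -> set T) (C : R) :
  (forall i, measurable (A i)) -> (forall t, \sum_i \1_(A i) t <= C) ->
  (\sum_i P (A i) <= C%:E)%E.
Proof.
move=> mA AC; rewrite -integral_sum_indic//.
rewrite -[leRHS]mule1 -(probability_setT P) -integral_cst//.
apply: ge0_le_integral => //.
- by move=> t _; rewrite lee_fin; exact: sumr_ge0.
- by apply/measurable_EFinP; apply: measurable_sum => i; exact: measurable_indic.
- by move=> t _; rewrite lee_fin.
Qed.

Section deviation_probability.
Context d1 d2 d3 (X : measurableType d1) (Y : measurableType d2)
  (Theta : measurableType d3) (R : realType).
Context (N k : nat) (f : Theta -> X -> Y) (F : finType) (c : Y -> F).
Hypothesis N_gt0 : (0 < N)%N.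
Hypothesis c_inj : injective c.
Hypothesis Y_discrete : forall B : set Y, measurable B.
Hypothesis f_measurable : measurable_fun [set: (Theta * X)%type]
  (fun p : Theta * X => f p.1 p.2).

Local Notation Omega := (sequences (X * Y)%type).
Local Notation patterns := {ffun 'I_N * 'I_k.+1 -> F}.
Implicit Types (w : Omega) (theta : Theta) (rho : R.-pker Omega ~> Theta).

(** Predictions are coded through [c] in the finite type [F], so that patterns can index finite sums
    and unions. *)
Definition pattern w theta : patterns :=
  [ffun ij : 'I_N * 'I_k.+1 => c (f theta (w (ij.1 + ij.2 * N)%N).1)].

Definition labels w : patterns := [ffun ij : 'I_N * 'I_k.+1 => c (w (ij.1 + ij.2 * N)%N).2].

Lemma Delta_pattern w theta :
  Delta N f k w theta = [set theta' | pattern w theta' = pattern w theta].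
Proof.
rewrite DeltaE//; apply/seteqP; split=> theta' /= h.
  by apply/ffunP => -[i j]; rewrite !ffunE /= h.
move=> i j; apply: c_inj.
by move/ffunP/(_ (i, j)): h; rewrite !ffunE.
Qed.

Lemma measurable_code d (S : measurableType d) (g : S -> Y) (y : F) :
  measurable_fun setT g -> measurable [set x | c (g x) = y].
Proof.
by move=> mg; have := mg measurableT (c @^-1` [set y]) (Y_discrete _); rewrite setTI.
Qed.

(** A jointly measurable set whose sections over [w] are the classes [Delta], or empty when no
    [theta] realizes [y]. *)
Definition pattern_graph (y : patterns) : set (Omega * Theta) :=
  [set p | pattern p.1 p.2 = y].

Lemma measurable_pattern_graph y : measurable (pattern_graph y).
Proof.
have -> : pattern_graph y = \bigcap_(ij in [set: 'I_N * 'I_k.+1])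
    [set p : Omega * Theta | c (f p.2 (p.1 (ij.1 + ij.2 * N)%N).1) = y ij].
  apply/seteqP; split=> p /= h.
    by move=> ij _; rewrite /= -h ffunE.
  by apply/ffunP => ij; rewrite ffunE; exact: h.
apply: fin_bigcap_measurable => [|ij _]; first exact: finite_finset.
apply: (measurable_code (g := fun p : Omega * Theta => f p.2 (p.1 (ij.1 + ij.2 * N)%N).1)).
apply: (measurableT_comp (g := fun p : Omega * Theta => (p.2, (p.1 (ij.1 + ij.2 * N)%N).1))
  f_measurable).
apply: measurable_fun_pair; first exact: measurable_snd.
apply: measurableT_comp; first exact: measurable_fst.
apply: (measurableT_comp (f := fun w : Omega => w (ij.1 + ij.2 * N)%N)).
  exact: measurable_coordinate.
exact: measurable_fst.
Qed.

Lemma xsection_pattern_graph w theta :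
  xsection (pattern_graph (pattern w theta)) w = Delta N f k w theta.
Proof. by rewrite Delta_pattern; apply/seteqP; split=> t; rewrite /xsection /= inE. Qed.

Lemma measurable_Delta w theta : measurable (Delta N f k w theta).
Proof.
rewrite -xsection_pattern_graph; apply: measurable_xsection.
exact: measurable_pattern_graph.
Qed.

Lemma measurable_pattern theta y : measurable [set w | pattern w theta = y].
Proof.
have -> : [set w | pattern w theta = y] = ysection (pattern_graph y) theta.
  by apply/seteqP; split=> w; rewrite /ysection /= inE.
by apply: measurable_ysection; exact: measurable_pattern_graph.
Qed.

(** The complement of the finite union, over codes [y], of the events where prediction and label
    both have code [y]. *)
Lemma measurable_error theta : measurable [set z : X * Y | f theta z.1 != z.2].
Proof.
have mf : measurable_fun setT (f theta).
  exact: (measurableT_comp f_measurable (measurable_pair1 theta)).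
have -> : [set z : X * Y | f theta z.1 != z.2] = ~` \bigcup_(y in [set: F])
    ([set z | c (f theta z.1) = y] `&` [set z | c z.2 = y]).
  apply/seteqP; split=> z /=.
    by move=> /eqP ne [y _ [/= e1 e2]]; apply/ne/c_inj; rewrite e1 e2.
  move=> h; apply/eqP => e; apply: h; exists (c z.2) => //; split=> //=.
  by rewrite e.
apply/measurableC/fin_bigcup_measurable => [|y _]; first exact: finite_finset.
apply: measurableI; last exact: measurable_code.
by apply: measurable_code; exact: measurableT_comp.
Qed.

Lemma measurable_rho_pattern rho y :
  measurable_fun [set: Omega] (fun w => rho w (xsection (pattern_graph y) w)).
Proof.
apply: measurable_fun_xsection_finite_kernel.
by rewrite inE; exact: measurable_pattern_graph.
Qed.

(** The set [Delta] varies with [w], so the lemma on kernels is applied to the graph [A] of [Delta]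
    for this [theta], a finite union over the pattern of [theta]. *)
Lemma measurable_rho_Delta rho theta :
  measurable_fun [set: Omega] (fun w => rho w (Delta N f k w theta)).
Proof.
pose A : set (Omega * Theta) := \bigcup_(y in [set: patterns])
  (pattern_graph y `&` ([set w | pattern w theta = y] `*` setT)).
have mA : measurable A.
  apply: fin_bigcup_measurable => [|y _]; first exact: finite_finset.
  apply: measurableI; first exact: measurable_pattern_graph.
  by apply: measurableX => //; exact: measurable_pattern.
have : A \in measurable by rewrite inE.
move=> /(measurable_fun_xsection_finite_kernel rho).
apply: eq_measurable_fun => w _; congr (rho w _).
rewrite Delta_pattern; apply/seteqP; split=> t; rewrite /xsection /= inE.
  by move=> [y _ [/= -> [/= ->]]].
by move=> e; exists (pattern w theta).
Qed.

Definition deviation_event rho (g : R) : set Omega :=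
  [set w | exists theta, deviates N k f rho g w theta].

(** Both risks are functions of the finite codes of predictions and labels, so they take finitely
    many values over all [w] and [theta]. *)
Let pattern_mean (y v : patterns) : R :=
  (N%:R * k.+1%:R)^-1 * \sum_(i < N) \sum_(j < k.+1) (y (i, j) != v (i, j))%:R.

Let pattern_risk (y v : patterns) : R :=
  N%:R^-1 * \sum_(i < N) (y (i, ord0) != v (i, ord0))%:R.

Let pattern_meanE w theta :
  mean_risk R N k f w theta = pattern_mean (pattern w theta) (labels w).
Proof.
rewrite /mean_risk; congr (_ * _); apply: eq_bigr => i _; apply: eq_bigr => j _.
by rewrite !ffunE /= (inj_eq c_inj).
Qed.

Let pattern_riskE w theta :
  empirical_risk R N f w theta = pattern_risk (pattern w theta) (labels w).
Proof.
rewrite /empirical_risk; congr (_ * _); apply: eq_bigr => i _.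
by rewrite !ffunE /= mul0n addn0 (inj_eq c_inj).
Qed.

Let pattern_mean_le1 y v : pattern_mean y v <= 1.
Proof.
rewrite /pattern_mean ler_pdivrMl ?mulr_gt0 ?ltr0n// mulr1.
apply: (@le_trans _ _ (\sum_(i < N) \sum_(j < k.+1) 1)).
  by apply: ler_sum => i _; apply: ler_sum => j _; case: eqP.
by rewrite !sumr_const !card_ord -mulrnA -natrM mulnC.
Qed.

(** The union over [Theta] becomes a finite union over codes, and for fixed codes the union over [a]
    is the preimage of an interval. *)
Lemma measurable_deviation_event rho g : measurable (deviation_event rho g).
Proof.
(* [S y v] is closed upwards, hence an interval: no measurability argument over the uncountably many
   [a] is required. *)
pose S y v : set R := [set x | exists2 a : R, 0 < a &
  dev_weight N a (pattern_mean y v) (pattern_risk y v) < x].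
pose G y w := g * fine (rho w (xsection (pattern_graph y) w)).
have -> : deviation_event rho g = \bigcup_(y in [set: patterns])
    \bigcup_(v in [set: patterns]) ([set w | labels w = v] `&` (G y @^-1` S y v)).
  apply/seteqP; split=> w /=.
    move=> [theta [a a0]]; rewrite pattern_meanE pattern_riskE => h.
    exists (pattern w theta) => //; exists (labels w) => //; split=> //=.
    by exists a => //; rewrite /G xsection_pattern_graph.
  move=> [y _ [v _ [/= <- [a a0]]]]; rewrite /G.
  (* A pattern realized by no [theta] has mass zero, which contradicts the positivity of the
     weight. *)
  have [->|/set0P [theta]] := eqVneq (xsection (pattern_graph y) w) set0.
    rewrite measure0 /= mulr0 => /ltW; rewrite leNgt.
    by rewrite dev_weight_gt0.
  rewrite /xsection /= inE => /= <-; rewrite -/(xsection _ _) => h; exists theta, a => //.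
  by rewrite pattern_meanE pattern_riskE -xsection_pattern_graph.
apply: fin_bigcup_measurable => [|y _]; first exact: finite_finset.
apply: fin_bigcup_measurable => [|v _]; first exact: finite_finset.
apply: measurableI.
  have -> : [set w | labels w = v] = \bigcap_(ij in [set: 'I_N * 'I_k.+1])
      [set w : Omega | c (w (ij.1 + ij.2 * N)%N).2 = v ij].
    apply/seteqP; split=> w /= h.
      by move=> ij _; rewrite /= -h ffunE.
    by apply/ffunP => ij; rewrite ffunE; exact: h.
  apply: fin_bigcap_measurable => [|ij _]; first exact: finite_finset.
  apply: (measurable_code (g := fun w : Omega => (w (ij.1 + ij.2 * N)%N).2)).
  apply: measurableT_comp; first exact: measurable_snd.
  exact: measurable_coordinate.
rewrite -[X in measurable X]setTI.
have mG : measurable_fun setT (G y).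
  apply: measurable_funM => //.
  by apply: (measurableT_comp (fine_measurable measurableT)); exact: measurable_rho_pattern.
apply: mG => //; apply: is_interval_measurable => x x' [a a0 ax] _ z /andP[xz _].
by exists a => //; exact: lt_le_trans xz.
Qed.

Hypothesis (rho : R.-pker Omega ~> Theta) (exch : partially_exchangeable N k rho).

Let sum_rho_pattern w :
  \sum_(y : patterns) fine (rho w (xsection (pattern_graph y) w)) = 1.
Proof.
have mD y : measurable (xsection (pattern_graph y) w).
  by apply: measurable_xsection; exact: measurable_pattern_graph.
apply: EFin_inj; rewrite -sumEFin.
under eq_bigr do rewrite fineK ?kernel_finite_transition//.
rewrite -(@prob_kernel _ _ _ _ _ rho w) fsbig_seq ?index_enum_uniq//.
rewrite -measure_fin_bigcup//.
- congr (rho w _); apply/seteqP; split=> // theta _.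
  by exists (pattern w theta); rewrite /xsection /= ?inE// mem_index_enum.
- by move=> y y' _ _ [theta []]; rewrite /xsection /= !inE /pattern_graph /= => -> ->.
Qed.

(** Rotations preserve the classes [Delta], so the classes at [w] serve for all [m]. A union bound
    over classes, each contributing in proportion to its mass, gives the result because the masses
    sum to 1. *)
Lemma sum_deviation_event_rot (g : R) w : 0 <= g ->
  \sum_(m : {ffun 'I_N -> 'I_k.+1})
    \1_(deviation_event rho g) (w \o rot_blocks N k (ord_ext m) : Omega) <=
  g * k.+1%:R ^+ N.
Proof.
move=> g0; pose dev (m : {ffun 'I_N -> 'I_k.+1}) theta :=
  deviates N k f rho g (w \o rot_blocks N k (ord_ext m)) theta.
pose D y := xsection (pattern_graph y) w.
apply: (@le_trans _ _ (\sum_(m : {ffun 'I_N -> 'I_k.+1}) \sum_(y : patterns)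
    (`[< exists2 theta, D y theta & dev m theta >])%:R)).
  apply: ler_sum => m _; rewrite indicE.
  have [|_] := boolP (_ \in _); last by rewrite sumr_ge0.
  rewrite inE => -[theta dtheta].
  rewrite (bigD1 (pattern w theta))//= -[leLHS]addr0 lerD ?sumr_ge0//.
  rewrite ler_nat lt0b; apply/asboolP; exists theta => //.
  by rewrite /D /xsection /= inE.
have -> : g * k.+1%:R ^+ N = \sum_(y : patterns) g * k.+1%:R ^+ N * fine (rho w (D y)).
  by rewrite -mulr_sumr sum_rho_pattern mulr1.
rewrite exchange_big /=; apply: ler_sum => y _.
have [D0|/set0P [theta Dtheta]] := eqVneq (D y) set0.
  rewrite big1 ?D0 ?measure0 ?mulr0// => m _.
  by case: asboolP => // -[theta].
have yE : y = pattern w theta by move: Dtheta; rewrite /D /xsection /= inE.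
have DE : D y = Delta N f k w theta by rewrite /D yE xsection_pattern_graph.
rewrite DE mulrAC.
apply: le_trans (sum_deviates_rot (f := f) N_gt0 measurable_Delta exch w theta g0).
apply: ler_sum => m _; rewrite ler_nat.
case: asboolP => // -[theta' Dtheta' dtheta'].
rewrite -(Delta_rot f N_gt0 m) in Dtheta'.
by rewrite lt0b; apply/asboolP; exact: deviates_Delta Dtheta' dtheta'.
Qed.

(** All rotated events have the same probability, so integrating the bound on their sum and dividing
    by the number of rotations suffices. *)
Lemma probability_deviation_event (P_ : 'I_N -> probability (X * Y)%type R)
    (P : probability Omega R) (g : R) : iid_blocks P_ P -> 0 <= g ->
  (P (deviation_event rho g) <= g%:E)%E.
Proof.
move=> PP g0; set E := deviation_event rho g.
have mE : measurable E by exact: measurable_deviation_event.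
pose Er (m : {ffun 'I_N -> 'I_k.+1}) : set Omega :=
  [set w : Omega | E (w \o rot_blocks N k (ord_ext m))].
have mEr m : measurable (Er m).
  have := measurable_comp_indices (T := (X * Y)%type) (rot_blocks N k (ord_ext m)) measurableT mE.
  by rewrite setTI.
have PEr m : P (Er m) = P E by exact: (iid_blocks_rot _ _ N_gt0 PP).
pose K : R := k.+1%:R ^+ N; have K0 : 0 < K by rewrite exprn_gt0.
have := sum_probability_le P mEr (fun w => sum_deviation_event_rot w g0).
under eq_bigr do rewrite PEr.
rewrite -(@fineK _ (P E)) ?fin_num_measure// sumEFin !lee_fin.
by rewrite sumr_const card_ffun !card_ord -[leLHS]mulr_natr natrX ler_pM2r.
Qed.

End deviation_probability.

(** * The function Phi_inv and layered sums *)

Definition phi_inv (R : realType) (a q : R) : R :=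
  (1 - expR (- (a * q))) / (1 - expR (- a)).

Section phi_inv.
Context (R : realType).
Implicit Types (a q : R).

Lemma one_subr_expRN_gt0 a : 0 < a -> 0 < 1 - expR (- a).
Proof. by move=> a0; rewrite subr_gt0 -expR0 ltr_expR oppr_lt0. Qed.

Lemma Phi_invE a q : Phi_inv a q%:E = (phi_inv a q)%:E.
Proof. by []. Qed.

(** This value is at least 1, which makes the bound trivial when [d_prime] is infinite. *)
Lemma Phi_invy a : 0 < a -> Phi_inv a +oo = ((1 - expR (- a))^-1)%:E.
Proof. by move=> a0; rewrite /Phi_inv gt0_muley ?lte_fin//= sube0 mul1e. Qed.

Lemma le_phi_inv a q q' : 0 < a -> q <= q' -> phi_inv a q <= phi_inv a q'.
Proof.
move=> a0 qq'; rewrite ler_pM2r ?invr_gt0 ?one_subr_expRN_gt0//.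
by rewrite lerD2l lerN2 ler_expR lerN2 ler_pM2l.
Qed.

Lemma phi_inv1 a : 0 < a -> phi_inv a 1 = 1.
Proof. by move=> a0; rewrite /phi_inv mulr1 divff// gt_eqF// one_subr_expRN_gt0. Qed.

(** Concavity, obtained from [1 + x <= expR x]; the slope is the derivative of [phi_inv a] at
    [q0]. *)
Lemma phi_inv_tangent a q q0 : 0 < a ->
  phi_inv a q <= phi_inv a q0 +
    a * expR (- (a * q0)) / (1 - expR (- a)) * (q - q0).
Proof.
move=> a0; have h := one_subr_expRN_gt0 a0.
rewrite /phi_inv mulrAC -mulrDl ler_pM2r ?invr_gt0//.
have -> : - (a * q) = - (a * q0) + a * (q0 - q) by ring.
rewrite expRD; have := expR_ge1Dx (a * (q0 - q)).
have := expR_gt0 (- (a * q0)).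
nra.
Qed.

(** Taking logarithms and dividing by [N] turns a lower bound on the weight into an upper bound on
    [p]. *)
Lemma le_phi_inv_dev_weight (N : nat) a p r x : (0 < N)%N -> 0 < a -> p <= 1 ->
  0 < x -> x <= dev_weight N a p r ->
  p <= phi_inv a (r - ln x / (a * N%:R)).
Proof.
move=> N0 a0 p1 x0; rewrite /dev_weight; set u := 1 - _ => xu.
have u0 : 0 < u by exact: dev_base_gt0.
have n0 : 0 < N%:R :> R by rewrite ltr0n.
rewrite /phi_inv ler_pdivlMr ?one_subr_expRN_gt0//.
suff : expR (- (a * (r - ln x / (a * N%:R)))) <= u by rewrite /u; lra.
rewrite -ler_ln ?posrE ?expR_gt0// expRK.
have : ln x <= (ln u + a * r) * N%:R.
  rewrite mulr_natr -[a * r]expRK -lnM ?posrE ?expR_gt0// -lnXn ?mulr_gt0 ?expR_gt0//.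
  by rewrite ler_ln// posrE exprn_gt0// mulr_gt0 ?expR_gt0.
have -> : - (a * (r - ln x / (a * N%:R))) = ln x / N%:R - a * r.
  by field; rewrite !gt_eqF.
by rewrite -ler_pdivrMr//; lra.
Qed.

End phi_inv.

(** Take the first [j] at which [b] fails, or [J.+1] if there is none. All increments before [j] are
    counted and telescope to [T j]; the others are nonnegative. The bound is linear in the [b i],
    hence easy to integrate. *)
Lemma layer_sum (R : realType) (T : nat -> R) (b : nat -> bool) (J : nat) :
  (forall j, (0 < j <= J)%N -> T j <= T j.+1) ->
  exists j, [/\ (0 < j <= J.+1)%N, (j <= J)%N -> ~~ b j &
    T j <= T 1%N + \sum_(1 <= i < J.+1) (T i.+1 - T i) * (b i)%:R].
Proof.
elim: J => [|J IH] Tnd; first by exists 1%N; rewrite big_geq// addr0.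
have [|j [/andP[j0 jJ] bj Tj]] := IH.
  by move=> i /andP[i0 iJ]; apply: Tnd; rewrite i0 ltnW.
have T0 : 0 <= T J.+2 - T J.+1 by rewrite subr_ge0 Tnd//= ltnSn.
rewrite big_nat_recr//= addrA.
have [jleJ|Jj] := leqP j J.
  exists j; split; [by rewrite j0 ltnW| by move=> _; exact: bj|].
  by rewrite (le_trans Tj)// lerDl mulr_ge0.
have {Jj bj jJ j0} jE : j = J.+1 by apply/eqP; rewrite eqn_leq jJ.
rewrite {}jE in Tj; have [bJ|bJ] := boolP (b J.+1).
  by exists J.+2; rewrite leqnn ltnn; split => //; rewrite mulr1; lra.
by exists J.+1; rewrite leqnSn; split=> //=; rewrite mulr0 addr0.
Qed.

(** By Abel summation the expression is [(1 - eta 1) u 1] plus the sum of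
    [(eta j - eta j.+1) u j.+1] over [1 <= j < J]. *)
Lemma weighted_increments_ge0 (R : realType) (eta u : nat -> R) (J : nat) :
  (0 < J)%N -> eta 1%N <= 1 ->
  (forall j, (0 < j < J)%N -> eta j.+1 <= eta j) ->
  (forall j, (0 < j <= J)%N -> 0 <= u j) ->
  0 <= u 1%N + \sum_(1 <= j < J) eta j * (u j.+1 - u j) - eta J * u J.
Proof.
case: J => // J _ eta1; elim: J => [|J IH] eta_dec u0.
  by rewrite big_geq// addr0; have := u0 1%N isT; nra.
rewrite big_nat_recr//=; set S := \sum_(_ <= _ < _) _.
have h : 0 <= u 1%N + S - eta J.+1 * u J.+1.
  apply: IH => j /andP[j0 jJ]; [apply: eta_dec|apply: u0]; rewrite j0/=; exact: ltnW.
have e : eta J.+2 <= eta J.+1 by apply: eta_dec; rewrite /= ltnSn.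
have uJ : 0 <= u J.+2 by apply: u0; rewrite /= leqnn.
have -> : u 1%N + (S + eta J.+1 * (u J.+2 - u J.+1)) - eta J.+2 * u J.+2 =
  (u 1%N + S - eta J.+1 * u J.+1) + (eta J.+1 - eta J.+2) * u J.+2 by ring.
by apply: addr_ge0 => //; apply: mulr_ge0; rewrite ?subr_ge0.
Qed.

(** * The bound given the first block *)

Lemma decreasing_gt0 (R : realType) (eta : nat -> R) (J : nat) :
  (forall j, (1 <= j < J)%N -> eta j.+1 < eta j) -> 0 < eta J ->
  forall j, (0 < j <= J)%N -> 0 < eta j.
Proof.
move=> eta_decr eta_gt0 j /andP[j0 jJ]; have J_gt0 := leq_trans j0 jJ; rewrite -(subKn jJ) in j0 *.
elim: (J - j)%N j0 => [|n IH] n0; first by rewrite subn0.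
have nJ : (n < J)%N by rewrite ltnW// -subn_gt0.
by rewrite (lt_trans (IH _)) ?subn_gt0// -(subnSK nJ) eta_decr// n0 ltn_subrL J_gt0.
Qed.

Section conditional_bound.
Context d (T : measurableType d) (R : realType) (P : probability T R).
(** Values intended once the first block is frozen: [p] is the mean risk, [r] the empirical risk,
    [G] the mass of [Delta], [kap] is [k(k+1)], and [B j] is the deviation event at level [j]. *)
Variables (N : nat) (p : T -> R) (r : R) (G : T -> \bar R).
Variables (eps kap : R) (J : nat) (eta : nat -> R) (B : nat -> set T).
Hypotheses (N_gt0 : (0 < N)%N) (mp : measurable_fun setT p).
Hypotheses (p_ge0 : forall t, 0 <= p t) (p_le1 : forall t, p t <= 1).
Hypotheses (r_ge0 : 0 <= r) (r_le1 : r <= 1).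
Hypotheses (mG : measurable_fun setT G).
Hypotheses (G_ge0 : forall t, (0 <= G t)%E) (G_le1 : forall t, (G t <= 1)%E).
Hypotheses (eps_gt0 : 0 < eps) (eps_le1 : eps <= 1) (kap_ge1 : 1 <= kap).
Hypotheses (J_gt0 : (0 < J)%N) (eta_lt1 : eta 1%N < 1).
Hypotheses (eta_decr : forall j, (1 <= j < J)%N -> eta j.+1 < eta j).
Hypotheses (eta_gt0 : 0 < eta J).
Hypotheses (mB : forall j, measurable (B j)).
Hypotheses (B_le : forall j, (0 < j <= J)%N -> (P (B j) <= (eta j)%:E)%E).
Hypotheses (devB : forall j t a, (0 < j <= J)%N -> 0 < a -> ~ B j t ->
  eps * eta j / (J%:R * kap) * fine (G t) <= dev_weight N a (p t) r).

(** The integrand of [d_prime]. It is nonnegative because [eps * G <= 1], and infinite where [G]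
    vanishes. *)
Let L t : \bar R := (- lne (eps%:E * G t))%E.

Let eta_pos j : (0 < j <= J)%N -> 0 < eta j.
Proof. exact: decreasing_gt0. Qed.

Let G_fin t : G t = (fine (G t))%:E.
Proof.
rewrite fineK// ge0_fin_numE//.
exact: le_lt_trans (G_le1 t) (ltry _).
Qed.

Let L_ge0 t : (0 <= L t)%E.
Proof.
rewrite oppe_ge0 lne_le0 G_fin -EFinM lee_fin.
have := G_le1 t; have := G_ge0 t; rewrite G_fin !lee_fin.
by move=> g0 g1; apply: mulr_ile1 => //; exact: ltW.
Qed.

Let mL : measurable_fun setT L.
Proof.
have -> : L = fun t => if fine (G t) <= 0 then +oo%E
    else (- ln (eps * fine (G t)))%:E.
  by apply/funext => t; rewrite /L G_fin /= pmulr_rle0//; case: ifP.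
have mfG : measurable_fun setT (fun t => fine (G t)).
  exact: (measurableT_comp (fine_measurable measurableT)).
apply: measurable_fun_ifT => //.
  exact: measurable_fun_ler.
apply/measurable_EFinP; apply: measurableT_comp => //.
apply: (measurableT_comp (@measurable_ln R)).
exact: measurable_funM.
Qed.

(* u j is the deviation level attached to eta j, in units of 1/lambda. *)
Let u (j : nat) : R := - ln (eps * eta j / (J%:R * kap)).

(** Truncation at [1 - r] reflects the trivial bound 1 on [p]; index [J.+1] is the fallback when
    every [B j] occurs. *)
Let lvl (lambda : R) (j : nat) : R :=
  if (j <= J)%N then Num.min (1 - r) (u j / lambda) else 1 - r.

Let Jn0 : 0 < J%:R :> R. Proof. by rewrite ltr0n. Qed.
Let kap_gt0 : 0 < kap. Proof. exact: lt_le_trans kap_ge1. Qed.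

Let uE j : (0 < j <= J)%N -> u j = ln J%:R + ln kap - ln eps - ln (eta j).
Proof.
move=> /eta_pos ej.
rewrite /u ln_div ?posrE ?mulr_gt0// !lnM ?posrE//; ring.
Qed.

Let u_nd j : (0 < j < J)%N -> u j <= u j.+1.
Proof.
move=> /andP[j0 jJ]; rewrite !uE ?j0 ?jJ ?(ltnW jJ)//.
rewrite lerD2l lerN2 ler_ln ?posrE ?eta_pos ?j0 ?jJ ?(ltnW jJ)//.
by apply/ltW/eta_decr; rewrite j0.
Qed.

Let lvl_nd lambda j : 0 < lambda -> (0 < j <= J)%N ->
  lvl lambda j <= lvl lambda j.+1.
Proof.
move=> l0 /andP[j0 jJ]; rewrite /lvl jJ; case: ifPn => [jJ'|_].
  by rewrite le_min !ge_min lexx/= ler_pM2r ?invr_gt0// u_nd ?j0// orbT.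
by rewrite ge_min lexx.
Qed.

Let level_sum lambda t : R := lvl lambda 1%N +
  \sum_(1 <= j < J.+1) (lvl lambda j.+1 - lvl lambda j) * (t \in B j)%:R.

(** [layer_sum] selects an index [j] with [t] outside of [B j], or the fallback. Here [x + ln eps]
    is [- ln (G t)]: the term in [eps] is already part of [u j]. *)
Let pointwise lambda t x : 0 < lambda -> L t = x%:E ->
  p t <= phi_inv (lambda / N%:R) (r + (x + ln eps) / lambda + level_sum lambda t).
Proof.
move=> l0 Lx; have n0 : 0 < N%:R :> R by rewrite ltr0n.
have a0 : 0 < lambda / N%:R by rewrite divr_gt0.
have g0 : 0 < fine (G t).
  rewrite ltNge; apply/negP => g0; move: Lx.
  by rewrite /L G_fin -EFinM /= pmulr_rle0// g0.
have xE : x = - ln eps - ln (fine (G t)).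
  move: Lx; rewrite /L G_fin -EFinM lne_EFin ?mulr_gt0// => -[<-].
  by rewrite lnM ?posrE// opprD.
have lng : ln (fine (G t)) <= 0.
  by rewrite ln_le0// -lee_fin -G_fin.
have [j [/andP[j0 jJ] Bj lvlj]] := @layer_sum R (lvl lambda) (fun j => t \in B j) J
  (fun j => lvl_nd l0).
apply: (@le_trans _ _ (phi_inv (lambda / N%:R) (r + (x + ln eps) / lambda + lvl lambda j))).
  have D0 : 0 <= (x + ln eps) / lambda.
    by rewrite divr_ge0 ?(ltW l0)// xE; lra.
  (* Since [phi_inv] is 1 at 1, this settles both the truncated levels and the fallback. *)
  have p1 : p t <= phi_inv (lambda / N%:R) (r + (x + ln eps) / lambda + (1 - r)).
    apply: le_trans (p_le1 t) _; rewrite -[leLHS](phi_inv1 a0).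
    by apply: le_phi_inv => //; lra.
  rewrite /lvl; case: ifPn => // jJ'.
  rewrite /Num.min; case: ifPn => // _.
  have j0J : (0 < j <= J)%N by rewrite j0.
  have /= := devB j0J a0 (t := t); have := Bj jJ'; rewrite notin_setE => nB /(_ nB).
  have c0 : 0 < eps * eta j / (J%:R * kap) by rewrite divr_gt0 ?mulr_gt0 ?eta_pos.
  move/(le_phi_inv_dev_weight N_gt0 a0 (p_le1 t) (mulr_gt0 c0 g0)).
  congr (_ <= phi_inv _ _).
  rewrite divfK ?gt_eqF// lnM ?posrE// xE /u.
  by move: (ln (_ / _)) => lc; field; rewrite gt_eqF.
by apply: le_phi_inv => //; rewrite lerD2l.
Qed.
Let cost : R := ln J%:R - ln (eta 1%N)
  + \sum_(1 <= j < J) eta j * ln (eta j / eta j.+1) + ln (eps * eta J / J%:R) * eta J.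

Let lvl_le lambda j : (j <= J)%N -> lvl lambda j <= u j / lambda.
Proof. by move=> jJ; rewrite /lvl jJ ge_min lexx orbT. Qed.

(** Replacing the truncated levels by [u j / lambda] can only increase the weighted sum, by
    [weighted_increments_ge0] applied to the differences. The untruncated sum is explicit, and the
    last increment yields [eta J * (1 - r)]. *)
Let weighted_levels lambda : 0 < lambda ->
  lvl lambda 1%N + \sum_(1 <= j < J.+1) eta j * (lvl lambda j.+1 - lvl lambda j)
    + ln eps / lambda <= eta J * (1 - r) + (cost + ln kap) / lambda.
Proof.
move=> l0; rewrite big_nat_recr//= [lvl _ J.+1]/lvl ltnn.
have J1 : (0 < J <= J)%N by rewrite J_gt0 leqnn.
have := @weighted_increments_ge0 R eta (fun j => u j / lambda - lvl lambda j) J J_gt0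
  (ltW eta_lt1) (fun j hj => ltW (eta_decr hj)).
have hu j : (0 < j <= J)%N -> 0 <= u j / lambda - lvl lambda j.
  by move=> /andP[_ jJ]; rewrite subr_ge0 lvl_le.
move=> /(_ hu).
have -> : \sum_(1 <= j < J) eta j * (u j.+1 / lambda - lvl lambda j.+1
      - (u j / lambda - lvl lambda j)) =
    (\sum_(1 <= j < J) eta j * ln (eta j / eta j.+1)) / lambda
    - \sum_(1 <= j < J) eta j * (lvl lambda j.+1 - lvl lambda j).
  rewrite mulr_suml -sumrB; apply: eq_big_nat => j /andP[j0 jJ].
  have ej : 0 < eta j by rewrite eta_pos// j0 ltnW.
  have ej1 : 0 < eta j.+1 by rewrite eta_pos.
  rewrite !uE ?j0 ?jJ ?(ltnW jJ)// ln_div ?posrE//; ring.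
set S1 := (\sum_(_ <= _ < _) _) ; set S2 := \sum_(_ <= _ < _) _.
rewrite /cost -/S1 [u J]/u.
have -> : ln (eps * eta J / (J%:R * kap)) = ln (eps * eta J / J%:R) - ln kap.
  by rewrite invfM mulrA -ln_div ?posrE// divr_gt0// mulr_gt0.
(* The computation gives a constant smaller by this amount, which is given up. *)
have kl : 0 <= eta J * ln kap / lambda.
  by rewrite divr_ge0 ?(ltW l0)// mulr_ge0 ?ln_ge0// ltW.
rewrite (uE (j := 1%N)) ?J_gt0// => h.
rewrite -subr_ge0; apply: le_trans (addr_ge0 h kl) _.
rewrite le_eqVlt; apply/orP; left; apply/eqP; field.
by rewrite gt_eqF.
Qed.

(** The tangent to [phi_inv] at the target argument [q0] bounds [p] by an affine function of [L] and
    of the indicators of the [B j]. After integration, the factor of the positive slope is at most 0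
    by [weighted_levels]. *)
Lemma conditional_bound lambda : 0 < lambda ->
  (\int[P]_t (p t)%:E <= Phi_inv (lambda / N%:R)
    ((r + eta J * (1 - r))%:E +
     (- (\int[P]_t lne (eps%:E * G t)) + cost%:E + (ln kap)%:E) * (lambda^-1)%:E))%E.
Proof.
move=> l0; have n0 : 0 < N%:R :> R by rewrite ltr0n.
have a0 : 0 < lambda / N%:R by rewrite divr_gt0.
have h := one_subr_expRN_gt0 a0.
have -> : (\int[P]_t lne (eps%:E * G t) = - \int[P]_t L t)%E.
  by rewrite -integral_ge0N//; apply: eq_integral => t _; rewrite oppeK.
rewrite oppeK.
have d0 : (0 <= \int[P]_t L t)%E by exact: integral_ge0.
have mpE : measurable_fun setT (fun t => (p t)%:E) by exact/measurable_EFinP.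
have intp_le1 : (\int[P]_t (p t)%:E <= 1)%E.
  rewrite -(@probability_setT _ _ _ P) -[leRHS]mul1e -integral_cst//.
  by apply: ge0_le_integral => // t _; rewrite lee_fin.
have intp_ge0 : (0 <= \int[P]_t (p t)%:E)%E.
  by apply: integral_ge0 => t _; rewrite lee_fin.
case d_eq : (\int[P]_t L t)%E d0 => [x| |]// d0; last first.
  rewrite !addye// gt0_mulye ?lte_fin ?invr_gt0// addey// Phi_invy//.
  apply: le_trans intp_le1 _; rewrite lee_fin -[leLHS]invr1.
  by rewrite lef_pV2 ?posrE// gerBl expR_ge0.
pose q0 := r + eta J * (1 - r) + (x + cost + ln kap) / lambda.
rewrite -!EFinD -/q0 Phi_invE; set a := lambda / N%:R in h a0 *.
pose s := a * expR (- (a * q0)) / (1 - expR (- a)).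
have s0 : 0 < s by rewrite divr_gt0// mulr_gt0// expR_gt0.
pose c0 := phi_inv a q0 + s * (r + ln eps / lambda + lvl lambda 1 - q0).
pose dl j := s * (lvl lambda j.+1 - lvl lambda j).
have dl0 j : (0 < j <= J)%N -> 0 <= dl j.
  by move=> jJ; rewrite mulr_ge0 ?(ltW s0)// subr_ge0 lvl_nd.
pose F1 t := \sum_(j < J) dl j.+1 * \1_(B j.+1) t.
(* Adding [|c0|] to both sides keeps every summand nonnegative, so that integrals can be split
   without integrability conditions. *)
pose F t := ((s / lambda)%:E * L t + (F1 t)%:E + (c0 + `|c0|)%:E)%E.
have sl0 : 0 < s / lambda by rewrite divr_gt0.
have dlS (j : 'I_J) : 0 <= dl j.+1 by rewrite dl0/=.
have F1_ge0 t : 0 <= F1 t by apply: sumr_ge0 => j _; rewrite mulr_ge0.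
have cc0 : 0 <= c0 + `|c0| by rewrite -lerBlDl sub0r -normrN ler_norm.
have le_F t : ((p t + `|c0|)%:E <= F t)%E.
  rewrite /F; case Lx : (L t) (L_ge0 t) => [y| |]// _; last first.
    by rewrite gt0_muley ?lte_fin// !addye// leey.
  rewrite -EFinM -!EFinD lee_fin addrA lerD2r.
  apply: le_trans (pointwise l0 Lx) _.
  apply: le_trans (phi_inv_tangent _ q0 a0) _; rewrite -/s /c0 /level_sum.
  have -> : F1 t =
      s * \sum_(1 <= j < J.+1) (lvl lambda j.+1 - lvl lambda j) * (t \in B j)%:R.
    rewrite big_add1 big_mkord mulr_sumr; apply: eq_bigr => j _.
    by rewrite indicE mulrA.
  rewrite le_eqVlt; apply/orP; left; apply/eqP; field.
  by rewrite gt_eqF.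
have mI j : measurable_fun setT (fun t => (\1_(B j) t)%:E : \bar R).
  by apply/measurable_EFinP; exact: measurable_indic.
have mF1 : measurable_fun setT (fun t => (F1 t)%:E).
  apply/measurable_EFinP; apply: measurable_sum => j.
  by apply: measurable_funM => //; exact: measurable_indic.
have intF1 : (\int[P]_t (F1 t)%:E = (\sum_(j < J) dl j.+1 * fine (P (B j.+1)))%:E)%E.
  rewrite -sumEFin; under eq_integral do rewrite -sumEFin.
  rewrite ge0_integral_sum//; last 2 first.
  - by move=> j; apply/measurable_EFinP; apply: measurable_funM => //; exact: measurable_indic.
  - by move=> j t _; rewrite lee_fin mulr_ge0.
  apply: eq_bigr => j _; under eq_integral do rewrite EFinM.
  rewrite ge0_integralZl//; last by rewrite lee_fin.
  by rewrite integral_indic// setIT [RHS]EFinM fineK// fin_num_measure.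
have msL : measurable_fun setT (fun t => (s / lambda)%:E * L t)%E.
  exact: measurable_funeM.
have : (\int[P]_t (p t + `|c0|)%:E <= \int[P]_t F t)%E.
  apply: ge0_le_integral => //.
  - by move=> t _; rewrite lee_fin addr_ge0.
  - by apply/measurable_EFinP; exact: measurable_funD.
  - by apply: emeasurable_funD => //; exact: emeasurable_funD.
under eq_integral do rewrite EFinD.
have sL0 t : (0 <= (s / lambda)%:E * L t)%E.
  by rewrite mule_ge0// lee_fin ltW.
rewrite ge0_integralD//; last by move=> t _; rewrite lee_fin.
rewrite /F ge0_integralD//; last 2 first.
- by move=> t _; rewrite adde_ge0// lee_fin.
- exact: emeasurable_funD.
rewrite ge0_integralD//; last by move=> t _; rewrite lee_fin.
rewrite ge0_integralZl//; last by rewrite lee_fin ltW.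
rewrite !integral_cst//= probability_setT !mule1 intF1 d_eq.
rewrite -[X in (X + _ <= _)%E]fineK; last first.
  by rewrite ge0_fin_numE// (le_lt_trans intp_le1)// ltry.
rewrite -EFinM -!EFinD lee_fin addrA lerD2r => le_int.
rewrite -[X in (X <= _)%E]fineK; last first.
  by rewrite ge0_fin_numE// (le_lt_trans intp_le1)// ltry.
rewrite lee_fin; apply: le_trans le_int _.
have le_pb : \sum_(j < J) dl j.+1 * fine (P (B j.+1)) <=
    s * \sum_(1 <= j < J.+1) eta j * (lvl lambda j.+1 - lvl lambda j).
  rewrite big_add1 big_mkord mulr_sumr; apply: ler_sum => j _.
  rewrite mulrCA -/(dl j.+1) mulrC ler_wpM2r//.
  by rewrite -lee_fin fineK ?fin_num_measure// B_le/=.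
have := weighted_levels l0; rewrite -/cost.
set W := \sum_(1 <= j < J.+1) _ in le_pb *; move=> hW.
rewrite /c0.
suff : s * (x / lambda + r + ln eps / lambda + lvl lambda 1 + W - q0) <= 0.
  move: le_pb; set V := \sum_(j < J) _ => le_pb hs.
  have e : s * (x / lambda + r + ln eps / lambda + lvl lambda 1 + W - q0) =
    s / lambda * x + s * W + s * (r + ln eps / lambda + lvl lambda 1 - q0) by ring.
  by move: hs; rewrite e; lra.
rewrite pmulr_rle0// /q0.
have -> : (x + cost + ln kap) / lambda = x / lambda + (cost + ln kap) / lambda by ring.
lra.
Qed.
End conditional_bound.

(** * Conditioning on the first block *)

Lemma probability_bigcup_le d (T : measurableType d) (R : realType)
    (P : probability T R) (F : nat -> set T) (eps : R) : 0 <= eps ->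
  (forall k, measurable (F k)) ->
  (forall k, (P (F k) <= (eps / (k.+1 * k.+2)%N%:R)%:E)%E) ->
  (P (\bigcup_k F k) <= eps%:E)%E.
Proof.
move=> e0 mF PF.
have mUF : measurable (\bigcup_k F k) by exact: bigcup_measurable.
apply: le_trans (generalized_Boole_inequality P mF mUF) _.
apply: lime_le; first by apply: is_cvg_nneseries => n _ _; exact: measure_ge0.
apply: nearW => n.
apply: (@le_trans _ _ (\sum_(0 <= k < n) (eps / (k.+1 * k.+2)%N%:R)%:E)%E).
  by apply: lee_sum => k _; exact: PF.
rewrite sumEFin lee_fin.
(* The series telescopes, as [1/(k(k+1))] is [1/k - 1/(k+1)]. *)
have -> : \sum_(0 <= k < n) (eps / (k.+1 * k.+2)%N%:R) = eps * (1 - n.+1%:R^-1).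
  elim: n => [|n IH]; first by rewrite big_geq// invr1 subrr mulr0.
  rewrite big_nat_recr//= IH natrM -[n.+2%:R]natr1.
  have : n.+1%:R != 0 :> R by rewrite pnatr_eq0.
  have : n.+1%:R + 1 != 0 :> R by rewrite natr1 pnatr_eq0.
  by move: n.+1%:R => x x1 x0; field; rewrite x0 x1.
by rewrite ler_piMr// gerBl invr_ge0.
Qed.

Lemma probability_tail_le d (T : measurableType d) (R : realType)
    (P : probability T R) (V : T -> \bar R) (c e : R) : 0 < c ->
  measurable_fun setT V -> (forall t, (0 <= V t)%E) ->
  (\int[P]_t V t <= (c * e)%:E)%E ->
  (P [set t | (c%:E < V t)%E] <= e%:E)%E.
Proof.
move=> c0 mV V0 intV.
have mS : measurable [set t | (c%:E < V t)%E].
  by rewrite -[X in measurable X]setTI; exact: emeasurable_fun_o_infty.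
have mS' : measurable [set t | (c%:E <= `|V t|)%E].
  rewrite -[X in measurable X]setTI; apply: emeasurable_fun_c_infty => //.
  exact: measurableT_comp.
apply: (@le_trans _ _ (P [set t | (c%:E <= `|V t|)%E])).
  by rewrite le_measure ?inE// => t /= /ltW; rewrite gee0_abs.
have := le_integral_abse P measurableT mV c0; rewrite setTI.
under eq_integral do rewrite gee0_abs//.
move=> /le_trans/(_ intV) /=; rewrite -(@fineK _ (P _)) ?fin_num_measure//.
by rewrite -EFinM !lee_fin ler_pM2l.
Qed.

Section first_block.
Context d (T : measurableType d) (R : realType) (N : nat).
Variables (P_ : 'I_N -> probability T R) (P : probability (sequences T) R).
Hypotheses (N_gt0 : (0 < N)%N) (P_iid : iid_blocks P_ P).
Local Notation Omega := (sequences T).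

Lemma measurable_splice_left (w : Omega) :
  measurable_fun [set: Omega] (fun w' => splice N w w' : Omega).
Proof.
exact: (measurableT_comp (measurable_splice (T := T) N) (measurable_pair1 w)).
Qed.

Lemma measurable_splice_set (A : set Omega) (w : Omega) : measurable A ->
  measurable [set w' : Omega | A (splice N w w')].
Proof.
move=> mA; have := measurable_splice_left w measurableT mA.
by rewrite setTI.
Qed.

Lemma first_block_condexp_indic (A : set Omega) (w : Omega) : measurable A ->
  first_block_condexp N P (EFin \o \1_A) w = P [set w' | A (splice N w w')].
Proof.
move=> mA; rewrite /first_block_condexp.
have mA' := measurable_splice_set w mA.
rewrite -[X in P X]setIT -integral_indic//.
Qed.

Lemma measurable_conditional_tail (A : set Omega) (c : R) : measurable A ->
  measurable [set w : Omega | (c%:E < P [set w' | A (splice N w w')])%E].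
Proof.
move=> mA; under eq_set do rewrite -first_block_condexp_indic//.
rewrite -[X in measurable X]setTI; apply: emeasurable_fun_o_infty => //.
apply: measurable_first_block_condexp => [|w]; last by rewrite lee_fin.
by apply/measurable_EFinP; exact: measurable_indic.
Qed.

(** Markov's inequality for the conditional probability of [A], whose mean is [P A]. *)
Lemma conditional_tail_le (A : set Omega) (c e : R) : 0 < c ->
  measurable A -> (P A <= (c * e)%:E)%E ->
  (P [set w : Omega | (c%:E < P [set w' | A (splice N w w')])%E] <= e%:E)%E.
Proof.
move=> c0 mA PA.
have mI : measurable_fun [set: Omega] (EFin \o \1_A : Omega -> \bar R).
  by apply/measurable_EFinP; exact: measurable_indic.
have I0 (w : Omega) : (0 <= (EFin \o \1_A) w :> \bar R)%E by rewrite lee_fin.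
under eq_set do rewrite -first_block_condexp_indic//.
apply: probability_tail_le => //.
- exact: measurable_first_block_condexp.
- by move=> w; exact: integral_ge0.
rewrite (first_block_condexpE N_gt0 P_iid mI I0 measurableT)//.
by rewrite integral_indic// setIT.
Qed.

(** Rotating columns of [j.+1] entries by [j] steps brings coordinate [i + j * N] to position [i],
    and [P] is invariant. *)
Lemma coordinate_block (A : set T) (i j : nat) : (i < N)%N -> measurable A ->
  P [set w : Omega | A (w (i + j * N)%N)] = P [set w : Omega | A (w i)].
Proof.
move=> iN mA; have mB : measurable [set w : Omega | A (w i)].
  by have := measurable_coordinate i measurableT mA; rewrite setTI.
rewrite -(iid_blocks_rot j (fun=> j) N_gt0 P_iid mB); congr (P _).
apply/seteqP; split=> w /=;
  by rewrite -[in rot_blocks _ _ _ i](addn0 i) -[in (i + 0)%N](mul0n N)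
    rot_blocksE// /cyc leq0n add0n modn_small.
Qed.
End first_block.

Section conditional_mean_risk.
Context d1 d2 d3 (X : measurableType d1) (Y : measurableType d2)
  (Theta : measurableType d3) (R : realType).
Context (N k : nat) (f : Theta -> X -> Y).
Variables (P_ : 'I_N -> probability (X * Y)%type R)
  (P : probability (sequences (X * Y)%type) R) (theta : Theta).
Hypotheses (N_gt0 : (0 < N)%N) (P_iid : iid_blocks P_ P).
Hypothesis m_error : measurable [set z : X * Y | f theta z.1 != z.2].
Local Notation Omega := (sequences (X * Y)%type).

Let m_err l : measurable [set w : Omega | f theta (w l).1 != (w l).2].
Proof.
have := measurable_coordinate (T := (X * Y)%type) l measurableT m_error.
by rewrite setTI.
Qed.

Lemma empirical_risk_splice (w w' : Omega) :
  empirical_risk R N f (splice N w w') theta = empirical_risk R N f w theta.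
Proof.
rewrite /empirical_risk; congr (_ * _); apply: eq_bigr => i _.
by rewrite /splice ltn_ord.
Qed.

Lemma mean_risk_splice (w w' : Omega) :
  mean_risk R N k f (splice N w w') theta = (N%:R * k.+1%:R)^-1 *
    (N%:R * empirical_risk R N f w theta + \sum_(ij : 'I_N * 'I_k)
      \1_[set w : Omega | f theta (w (ij.1 + ij.2.+1 * N)%N).1
                          != (w (ij.1 + ij.2.+1 * N)%N).2] w').
Proof.
rewrite /mean_risk; congr (_ * _).
rewrite /empirical_risk mulVKf ?pnatr_eq0 -?lt0n//.
rewrite -(pair_big xpredT xpredT (fun (i : 'I_N) (j : 'I_k) => \1_[set w : Omega |
  f theta (w (i + j.+1 * N)%N).1 != (w (i + j.+1 * N)%N).2] w')) /= -big_split /=.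
apply: eq_bigr => i _; rewrite big_ord_recl /= mul0n addn0; congr (_ + _).
  by rewrite /splice ltn_ord.
apply: eq_bigr => j _; rewrite indicE /splice /bump /= add1n mulSn addnCA.
by rewrite ltnNge leq_addr /= mem_setE.
Qed.

Lemma measurable_mean_risk_splice (w : Omega) :
  measurable_fun [set: Omega] (fun w' => mean_risk R N k f (splice N w w') theta).
Proof.
apply: (eq_measurable_fun (fun w' => (N%:R * k.+1%:R)^-1 *
    (N%:R * empirical_risk R N f w theta + \sum_(ij : 'I_N * 'I_k)
      \1_[set w : Omega | f theta (w (ij.1 + ij.2.+1 * N)%N).1
                          != (w (ij.1 + ij.2.+1 * N)%N).2] w'))) => [w' _|].
  by rewrite mean_risk_splice.
apply: measurable_funM => //; apply: measurable_funD => //.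
by apply: measurable_sum => ij; apply: measurable_indic; exact: m_err.
Qed.

(** The first block is frozen and contributes [r1]; each of the [k] other blocks has the law of the
    first and contributes the risk. *)
Lemma conditional_mean_risk (w : Omega) :
  (\int[P]_w' (mean_risk R N k f (splice N w w') theta)%:E =
   ((empirical_risk R N f w theta + k%:R * risk N f P theta) / k.+1%:R)%:E)%E.
Proof.
set A := fun ij : 'I_N * 'I_k => [set w : Omega |
  f theta (w (ij.1 + ij.2.+1 * N)%N).1 != (w (ij.1 + ij.2.+1 * N)%N).2].
have mA ij : measurable (A ij) by exact: m_err.
have mS : measurable_fun setT (fun w' : Omega => (\sum_ij \1_(A ij) w')%:E : \bar R).
  by apply/measurable_EFinP; apply: measurable_sum => ij; exact: measurable_indic.
have r0 : 0 <= N%:R * empirical_risk R N f w theta.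
  by rewrite !mulr_ge0// ?invr_ge0// sumr_ge0.
under eq_integral do rewrite mean_risk_splice EFinM EFinD.
rewrite ge0_integralZl//; last 2 first.
- exact: emeasurable_funD.
- by move=> w' _; rewrite adde_ge0// lee_fin// sumr_ge0.
rewrite ge0_integralD//; last by move=> w' _; rewrite lee_fin sumr_ge0.
rewrite integral_cst//= probability_setT mule1 integral_sum_indic//.
have PA (ij : 'I_N * 'I_k) :
    P (A ij) = (fine (P [set w | f theta (w ij.1).1 != (w ij.1).2]))%:E.
  rewrite fineK; last by apply: fin_num_measure; exact: m_err.
  exact: (coordinate_block N_gt0 P_iid ij.2.+1 (ltn_ord ij.1) m_error).
under eq_bigr do rewrite PA.
rewrite sumEFin -EFinD -EFinM; congr (_%:E).
rewrite -(pair_big xpredT xpredT (fun (i : 'I_N) (j : 'I_k) =>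
  fine (P [set w | f theta (w i).1 != (w i).2]))) /=.
under [X in _ * (_ + X)]eq_bigr do rewrite sumr_const card_ord -mulr_natl.
rewrite -mulr_sumr /risk.
have n0 : N%:R != 0 :> R by rewrite pnatr_eq0 -lt0n.
have k0 : k.+1%:R != 0 :> R by rewrite pnatr_eq0.
by move: k.+1%:R k0 => K k0; field; rewrite n0 k0.
Qed.
End conditional_mean_risk.

(** * Union bound over [k] and [j], and the final inequality *)

Theorem theorem3p3p3 (R : realType)
    (d1 d2 d3 : measure_display) (X : measurableType d1) (Y : measurableType d2)
    (Theta : measurableType d3)
    (Y_finite : finite_set [set: Y])
    (Y_discrete : forall B : set Y, measurable B)
    (N : nat) (N_gt0 : (0 < N)%N)
    (P_ : 'I_N -> probability (X * Y)%type R)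
    (P : probability (sequences (X * Y)%type) R) (P_iid : iid_blocks P_ P)
    (f : Theta -> X -> Y)
    (f_measurable : measurable_fun [set: (Theta * X)%type]
       (fun p : Theta * X => f p.1 p.2))
    (eps : R) (eps_gt0 : 0 < eps) (eps_le1 : eps <= 1)
    (J : nat) (J_gt0 : (0 < J)%N) (eta : nat -> R)
    (eta_lt1 : eta 1%N < 1)
    (eta_decr : forall j, (1 <= j < J)%N -> eta j.+1 < eta j)
    (eta_gt0 : 0 < eta J)
    (pi_ : forall k : nat, R.-pker sequences (X * Y)%type ~> Theta)
    (pi_exch : forall k, (0 < k)%N -> partially_exchangeable N k (pi_ k)) :
  exists E : set (sequences (X * Y)%type),
    [/\ measurable E, ((1 - eps)%:E <= P E)%E &
      forall w, E w -> forall theta : Theta,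
        let r1 := empirical_risk R N f w theta in
        ((risk N f P theta)%:E <=
         ereal_inf [set (k.+1%:R / k%:R)%:E *
             ereal_inf [set Phi_inv (lambda / N%:R)%R
                 ((r1 + eta J * (1 - r1))%:E
                  + (d_second N f P eps k (pi_ k) J eta w theta
                     + (ln (k * k.+1)%N%:R)%:E) * (lambda^-1)%:E)
               | lambda in [set lambda : R | (0 < lambda)%R]]
             - (r1 / k%:R)%:E
           | k in [set k : nat | (0 < k)%N]])%E].
Proof.
have /finite_seqP[s Ys] := Y_finite.
have sY y : y \in s by have : [set: Y] y by []; rewrite Ys.
pose c y : seq_sub s := SeqSub (sY y).
have c_inj : injective c by move=> y y' /(congr1 val).
have eta_pos := decreasing_gt0 eta_decr eta_gt0.
pose kap (k : nat) : R := (k * k.+1)%N%:R.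
(* The factor [eta j] cancels against the threshold in Markov's inequality, leaving
   [eps / (J k (k+1))] for each pair. *)
pose g k j : R := eps * eta j / (J%:R * kap k).
pose A k j := deviation_event N k f (pi_ k) (g k j).
have mA k j : measurable (A k j).
  exact: (measurable_deviation_event k N_gt0 c_inj Y_discrete f_measurable).
pose V k j := [set w : sequences (X * Y)%type |
  ((eta j)%:E < P [set w' | A k j (splice N w w')])%E].
have mV k j : measurable (V k j) by exact: measurable_conditional_tail.
(* Both [k] and [j] are shifted by one, since the levels and the posteriors of interest start at
   1. *)
pose U k := \big[setU/set0]_(j < J) V k.+1 j.+1.
have mU k : measurable (U k) by apply: bigsetU_measurable => j _.
have PU k : (P (U k) <= (eps / (k.+1 * k.+2)%N%:R)%:E)%E.
  have mVk i : (i < J)%N -> measurable (V k.+1 i.+1) by [].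
  apply: le_trans (Boole_inequality P mVk) _.
  apply: (@le_trans _ _ (\sum_(j < J) (eps / (J%:R * kap k.+1))%:E)%E).
    apply: lee_sum => j _; have ej := eta_pos j.+1 (ltn_ord j).
    apply: (conditional_tail_le N_gt0 P_iid) => //.
    have g0 : 0 <= g k.+1 j.+1 by rewrite divr_ge0 ?mulr_ge0// ltW.
    have := probability_deviation_event N_gt0 c_inj Y_discrete f_measurable
      (pi_exch k.+1 (ltn0Sn k)) P_iid g0.
    by move=> /le_trans; apply; rewrite lee_fin /g mulrCA mulrA.
  rewrite sumEFin lee_fin sumr_const card_ord -[leLHS]mulr_natr /kap.
  have Jn0 : J%:R != 0 :> R by rewrite pnatr_eq0 -lt0n.
  have K0 : (k.+1 * k.+2)%N%:R != 0 :> R by rewrite pnatr_eq0 muln_eq0.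
  move: (k.+1 * k.+2)%N%:R K0 => K K0.
  by rewrite le_eqVlt; apply/orP; left; apply/eqP; field; rewrite Jn0 K0.
exists (~` \bigcup_k U k); split.
- by apply/measurableC/bigcup_measurable.
- rewrite probability_setC; last exact: bigcup_measurable.
  by rewrite EFinB leeB// (probability_bigcup_le (ltW eps_gt0)).
move=> w Ew theta; set r1 := empirical_risk R N f w theta; lazy zeta.
have PV k j : (0 < k)%N -> (0 < j <= J)%N ->
    (P [set w' | A k j (splice N w w')] <= (eta j)%:E)%E.
  case: k => // k _; case: j => // j /= jJ; rewrite leNgt; apply/negP => h.
  apply: Ew; exists k => //; rewrite /U -(bigcup_mkord J (fun j => V k.+1 j.+1)).
  by exists j.
have m_error := measurable_error c_inj Y_discrete f_measurable theta.
have n0 : N%:R != 0 :> R by rewrite pnatr_eq0 -lt0n.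
have r1_ge0 : 0 <= r1 by rewrite mulr_ge0 ?invr_ge0// sumr_ge0.
have r1_le1 : r1 <= 1.
  rewrite /r1 /empirical_risk ler_pdivrMl ?ltr0n// mulr1.
  apply: (@le_trans _ _ (\sum_(i < N) 1)); last by rewrite sumr_const card_ord.
  by apply: ler_sum => i _; case: eqP.
apply: le_ereal_inf_tmp => _ [k k0 <-].
have kR : 0 < k%:R :> R by rewrite ltr0n.
have kS : 0 < k.+1%:R :> R by rewrite ltr0n.
rewrite leeBrDr//.
(* The risk plus [r1 / k] is [(k+1)/k] times the conditional mean of the mean risk, so the prefactor
   cancels. *)
have -> : ((risk N f P theta)%:E + (r1 / k%:R)%:E =
    (k.+1%:R / k%:R)%:E * ((r1 + k%:R * risk N f P theta) / k.+1%:R)%:E)%E.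
  rewrite -EFinD -EFinM; congr (_%:E).
  by move: k.+1%:R kS => K K0; field; rewrite !gt_eqF.
rewrite lee_pmul2l ?lte_fin ?divr_gt0//.
apply: le_ereal_inf_tmp => _ [lambda lambda0 <-].
rewrite -(conditional_mean_risk k N_gt0 P_iid m_error).
have mD := measurable_Delta k N_gt0 c_inj Y_discrete f_measurable.
have mspl := measurable_splice_left (T := (X * Y)%type) N w.
apply: (@conditional_bound _ _ _ P N _ r1
  (fun w' => pi_ k (splice N w w') (Delta N f k (splice N w w') theta)) eps (kap k) J eta
  (fun j => [set w' | A k j (splice N w w')])) => //.
- exact: measurable_mean_risk_splice.
- by move=> w'; exact: mean_risk_ge0.
- by move=> w'; exact: mean_risk_le1.
- exact: (measurableT_comp (measurable_rho_Delta k N_gt0 c_inj Y_discrete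
    f_measurable (pi_ k) theta) mspl).
- by move=> w'; rewrite -(@prob_kernel _ _ _ _ _ (pi_ k) (splice N w w')) le_measure ?inE.
- by rewrite /kap ler1n muln_gt0 k0.
- by move=> j; exact: measurable_splice_set.
- by move=> j jJ; exact: PV.
(* A violation at this [theta] and [a] would itself place the spliced sequence in the deviation
   event. *)
- move=> j w' a jJ a0 nA; rewrite leNgt; apply/negP => h; apply: nA.
  by exists theta, a => //; rewrite empirical_risk_splice.
Qed.
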